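(* Let $a,b,c,h\in\mathbb{C}$ and let $V$ be any highest weight module over the Neveu-Schwarz algebra $\mathfrak{NS}$ with highest weight vector $u$ of weight $(c,h)$ ($V$ not necessarily simple). Then $\mathrm{End}_{\mathfrak{NS}}(V\otimes SA'_{a,b})\cong\mathbb{C}$.
   Context: The ground field is $\mathbb{C}$. The Neveu-Schwarz algebra $\mathfrak{NS}$ is the Lie superalgebra with even part having basis $\{L_n, C : n\in\mathbb{Z}\}$ and odd part having basis $\{G_r : r\in\frac12+\mathbb{Z}\}$, with brackets $[L_m,L_n]=(n-m)L_{m+n}+\delta_{m+n,0}\frac{m^3-m}{12}C$, $[L_m,G_r]=(r-\frac m2)G_{m+r}$, $[G_r,G_s]=2L_{r+s}-\frac13\delta_{r+s,0}(r^2-\frac14)C$, and $C$ central. Let $\mathfrak{n}^+$ be the span of all $L_i$ ($i\in\mathbb{Z}$, $i>0$) and $G_r$ ($r\in\frac12+\mathbb{Z}$, $r>0$). A highest weight module of weight $(c,h)$ is a ($\mathbb{Z}_2$-graded) $\mathfrak{NS}$-module generated by a nonzero even vector $u$ with $\mathfrak{n}^+u=0$, $L_0u=hu$, $Cu=cu$. For $a,b\in\mathbb{C}$, $SA_{a,b}$ is the $\mathfrak{NS}$-module with even basis $\{x_i: i\in\mathbb{Z}\}$, odd basis $\{y_{\frac12+i}: i\in\mathbb{Z}\}$ and action (for $i,j\in\mathbb{Z}$) $L_ix_j=(a+j+ib)x_{i+j}$, $L_iy_{\frac12+j}=(a+\frac12+j+i(b-\frac12))y_{\frac12+i+j}$,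 $G_{\frac12+i}x_j=y_{\frac12+i+j}$, $G_{\frac12+i}y_{\frac12+j}=(a+\frac12+j+2(\frac12+i)(b-\frac12))x_{1+i+j}$, and $C$ acts by $0$. The irreducible module $SA'_{a,b}$ is defined as follows. If $a\in\mathbb{Z}$ and $b=1$, $SA'_{a,1}$ is the submodule of $SA_{a,1}$ spanned by all $y_{\frac12+j}$ ($j\in\mathbb{Z}$) and all $x_j$ with $j\ne -a$. If $a\in\frac12+\mathbb{Z}$ and $b=\frac12$, $SA'_{a,\frac12}=SA_{a,\frac12}/\mathbb{C}y_{-a}$. In all other cases $SA'_{a,b}=SA_{a,b}$. Tensor products carry the super action $g(v\otimes w)=gv\otimes w+(-1)^{|g||v|}v\otimes gw$ for homogeneous $g,v$. $\mathrm{End}_{\mathfrak{NS}}$ denotes the algebra of linear endomorphisms commuting with the action of every element of $\mathfrak{NS}$. *)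

(* Defs.v *)
From HB Require Import structures.
From mathcomp Require Import all_boot all_order all_algebra generic_quotient.
From mathcomp Require Import ring_quotient.
From mathcomp Require Import boolp classical_sets functions reals complex.
From mathcomp Require Import finmap monalg.
From mathcomp Require Import ring zify.

Set Implicit Arguments.
Unset Strict Implicit.
Unset Printing Implicit Defensive.

Import GRing.Theory Num.Theory.
Local Open Scope ring_scope.
Local Open Scope quotient_scope.

Section Subspace.
Variables (F : numFieldType) (V : lmodType F).

Record subspace := Subspace {
  in_subspace :> V -> Prop;
  subspace0 : in_subspace 0;
  subspace_lin : forall k x y,
    in_subspace x -> in_subspace y -> in_subspace (k *: x + y) }.

Implicit Types (S : subspace) (A : set V).

Lemma subspaceD S x y : S x -> S y -> S (x + y).
Proof. by move=> Sx Sy; rewrite -[x]scale1r; apply: subspace_lin. Qed.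

Lemma subspaceZ S k x : S x -> S (k *: x).
Proof.
by move=> Sx; rewrite -[_ *: _]addr0; apply: subspace_lin => //; exact: subspace0.
Qed.

Lemma subspaceN S x : S x -> S (- x).
Proof. by rewrite -scaleN1r; exact: subspaceZ. Qed.

Lemma subspaceB S x y : S x -> S y -> S (x - y).
Proof. by move=> Sx Sy; apply: subspaceD => //; apply: subspaceN. Qed.

Lemma subspace_sum S I (r : seq I) (P : pred I) (f : I -> V) :
  (forall i, P i -> S (f i)) -> S (\sum_(i <- r | P i) f i).
Proof. by move=> H; apply: big_ind => //; [exact: subspace0|exact: subspaceD]. Qed.

Definition span_mem A x := forall S, (forall y, A y -> S y) -> S x.

Lemma span0 A : span_mem A 0.
Proof. by move=> S _; exact: subspace0. Qed.

Lemma span_lin A k x y :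
  span_mem A x -> span_mem A y -> span_mem A (k *: x + y).
Proof. by move=> Ax Ay S AS; apply: subspace_lin; [exact: Ax S AS|exact: Ay S AS]. Qed.

Definition span A : subspace := Subspace (@span0 A) (@span_lin A).

Lemma span_sub A x : A x -> span A x.
Proof. by move=> Ax S; apply. Qed.

Lemma span_ind A (P : V -> Prop) : P 0 ->
  (forall k x y, P x -> P y -> P (k *: x + y)) ->
  (forall x, A x -> P x) -> forall x, span A x -> P x.
Proof. by move=> P0 PL PA x /(_ (Subspace P0 PL)); apply. Qed.

Definition subspace_pred S : {pred V} := fun x => `[< S x >].

Lemma subspace_predE S x : (x \in subspace_pred S) = `[< S x >].
Proof. by []. Qed.

Lemma subspace_pred_closed S : submod_closed (subspace_pred S).
Proof.
split=> [|k x y]; first by apply/asboolP; exact: subspace0.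
by move=> /asboolP Sx /asboolP Sy; apply/asboolP; exact: subspace_lin.
Qed.

HB.instance Definition _ S :=
  GRing.isSubmodClosed.Build F V (subspace_pred S) (subspace_pred_closed S).

Definition sub_lmod S := {x : V | x \in subspace_pred S}.
HB.instance Definition _ S := SubChoice.on (sub_lmod S).
HB.instance Definition _ S := [SubChoice_isSubLmodule of sub_lmod S by <:].

End Subspace.

Section Quotient.
Variables (F : numFieldType) (V : lmodType F) (S : subspace V).

Definition quot_lmod := Quotient.quot (subspace_pred S).
HB.instance Definition _ := GRing.Zmodule.on quot_lmod.

Definition quot_pi (x : V) : quot_lmod := \pi_(Quotient.quot (subspace_pred S)) x.

Lemma quot_piP x y : quot_pi x = quot_pi y <-> S (x - y).
Proof.
rewrite /quot_pi; split=> [/eqP|Sxy].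
  by rewrite -Quotient.idealrBE => /asboolP.
by apply/eqP; rewrite -Quotient.idealrBE; apply/asboolP.
Qed.

Lemma quot_piD : {morph quot_pi : x y / x + y}.
Proof. by move=> x y; rewrite /quot_pi raddfD. Qed.

Lemma quot_pi0 : quot_pi 0 = 0.
Proof. by rewrite /quot_pi raddf0. Qed.

Lemma quot_reprK : cancel (repr : quot_lmod -> V) quot_pi.
Proof. by move=> q; exact: reprK. Qed.

Lemma quot_pi_ind (P : quot_lmod -> Prop) :
  (forall x, P (quot_pi x)) -> forall q, P q.
Proof. by move=> H q; rewrite -[q]quot_reprK. Qed.

Definition quot_scale (k : F) (q : quot_lmod) : quot_lmod :=
  quot_pi (k *: repr q).

Lemma quot_scaleE k x : quot_scale k (quot_pi x) = quot_pi (k *: x).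
Proof.
apply/quot_piP; rewrite -scalerBr; apply: subspaceZ.
by apply/quot_piP; rewrite quot_reprK.
Qed.

Lemma quot_scaleA a b q :
  quot_scale a (quot_scale b q) = quot_scale (a * b) q.
Proof. by elim/quot_pi_ind: q => x; rewrite !quot_scaleE scalerA. Qed.

Lemma quot_scale1 : left_id 1 quot_scale.
Proof. by elim/quot_pi_ind => x; rewrite !quot_scaleE scale1r. Qed.

Lemma quot_scaleDr : right_distributive quot_scale +%R.
Proof.
move=> k; elim/quot_pi_ind => x; elim/quot_pi_ind => y.
by rewrite -quot_piD !quot_scaleE scalerDr quot_piD.
Qed.

Lemma quot_scaleDl q : {morph quot_scale^~ q : a b / a + b}.
Proof.
by move=> a b /=; elim/quot_pi_ind: q => x; rewrite !quot_scaleE scalerDl quot_piD.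
Qed.

HB.instance Definition _ := GRing.Zmodule_isLmodule.Build F quot_lmod
  quot_scaleA quot_scale1 quot_scaleDr quot_scaleDl.

Lemma quot_pi_is_linear : linear quot_pi.
Proof. by move=> k x y; rewrite quot_piD -quot_scaleE. Qed.

HB.instance Definition _ :=
  GRing.isLinear.Build F V quot_lmod *:%R quot_pi quot_pi_is_linear.

Lemma quot_pi_eq0 x : S x -> quot_pi x = 0.
Proof. by move=> Sx; rewrite -quot_pi0; apply/quot_piP; rewrite subr0. Qed.

Section Lift.
Variables (U : lmodType F) (f : V -> U).

Definition quot_lift (q : quot_lmod) : U := f (repr q).

Hypothesis f_lin : linear f.
Hypothesis f_S : forall x, S x -> f x = 0.

Lemma quot_liftE x : quot_lift (quot_pi x) = f x.
Proof.
rewrite /quot_lift; set y := repr _.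
have /f_S : S (y - x) by apply/quot_piP; rewrite quot_reprK.
by rewrite addrC -scaleN1r f_lin scaleN1r addrC => /subr0_eq.
Qed.

Lemma quot_lift_linear : linear quot_lift.
Proof.
move=> k; elim/quot_pi_ind => x; elim/quot_pi_ind => y.
by rewrite -quot_pi_is_linear !quot_liftE f_lin.
Qed.
End Lift.

End Quotient.

Section LinearExtension.
Variables (F : numFieldType) (K : choiceType).
Implicit Types U : lmodType F.

(** [{malg F[K]}] is the vector space with basis [<< k >>], for [k : K]. *)
Lemma malg_ind (P : {malg F[K]} -> Prop) : P 0 ->
  (forall k x y, P x -> P y -> P (k *: x + y)) ->
  (forall k, P << k >>) -> forall x, P x.
Proof.
move=> P0 PL PB x; rewrite [x]monalgE; apply: big_ind => //.
  by move=> y z Py Pz; rewrite -[y]scale1r; apply: PL.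
move=> k _; have -> : << x@_k *g k >> = x@_k *: << k >> + 0 :> {malg F[K]}.
  by rewrite addr0; apply/malgP => j; rewrite mcoeffZ !mcoeffU mulrnAr mulr1.
exact: PL.
Qed.

Definition lin_ext U (f : K -> U) (x : {malg F[K]}) : U :=
  \sum_(k <- msupp x) x@_k *: f k.

Lemma lin_extw U (f : K -> U) x (d : {fset K}) : (msupp x `<=` d)%fset ->
  lin_ext f x = \sum_(k <- d) x@_k *: f k.
Proof.
move=> le_d; rewrite /lin_ext (big_fset_incl _ le_d) //= => k _.
by move=> /mcoeff_outdom ->; rewrite scale0r.
Qed.

Lemma lin_ext_linear U (f : K -> U) : linear (lin_ext f).
Proof.
move=> k x y; pose d := (msupp x `|` msupp y)%fset.
have le_x : (msupp x `<=` d)%fset by exact: fsubsetUl.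
have le_y : (msupp y `<=` d)%fset by exact: fsubsetUr.
have le_kxy : (msupp (k *: x + y) `<=` d)%fset.
  apply: fsubset_trans (msuppD_le _ _) _; rewrite fsubUset le_y andbT.
  exact: fsubset_trans (msuppZ_le _ _) le_x.
rewrite (lin_extw _ le_x) (lin_extw _ le_y) (lin_extw _ le_kxy).
rewrite scaler_sumr -big_split /=; apply: eq_bigr => j _.
by rewrite mcoeffD mcoeffZ scalerDl scalerA.
Qed.

HB.instance Definition _ U (f : K -> U) :=
  GRing.isLinear.Build F {malg F[K]} U *:%R (lin_ext f) (lin_ext_linear f).

Lemma lin_extE U (f : K -> U) k : lin_ext f << k >> = f k.
Proof.
by rewrite (lin_extw _ msuppU_le) big_seq_fset1 mcoeffUU scale1r.
Qed.

End LinearExtension.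

Definition bilin_ext (F : numFieldType) (K K' : choiceType) (U : lmodType F)
    (f : K -> K' -> U) (x : {malg F[K]}) (y : {malg F[K']}) : U :=
  lin_ext (fun k => lin_ext (f k) y) x.

Section BilinearExtension.
Variables (F : numFieldType) (K K' : choiceType) (U : lmodType F).
Variable f : K -> K' -> U.

Lemma bilin_extE k k' : bilin_ext f << k >> << k' >> = f k k'.
Proof. by rewrite /bilin_ext !lin_extE. Qed.

Lemma bilin_ext_linl y : linear (bilin_ext f ^~ y).
Proof. exact: lin_ext_linear. Qed.

Lemma bilin_ext_linr x : linear (bilin_ext f x).
Proof.
move=> k y z; rewrite /bilin_ext /lin_ext scaler_sumr -big_split /=.
apply: eq_bigr => j _; rewrite -!/(lin_ext _ _) linearP scalerDr !scalerA.
by rewrite mulrC.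
Qed.
End BilinearExtension.

Record superspace (F : numFieldType) := Superspace {
  ss_lmod :> lmodType F;
  (* [part false] is the even part, [part true] the odd part *)
  part : bool -> subspace ss_lmod;
  part_sum : forall v, exists v0 v1,
    [/\ part false v0, part true v1 & v = v0 + v1];
  part_cap : forall v, part false v -> part true v -> v = 0 }.

Arguments part {F s}.

Section Projections.
Variables (F : numFieldType) (V : superspace F).
Implicit Types (b : bool) (v w : V).

Lemma part_sumT v : {w : V * V |
  [/\ part false w.1, part true w.2 & v = w.1 + w.2]}.
Proof.
apply: cid; have [v0 [v1 [H0 H1 e]]] := part_sum v.
by exists (v0, v1).
Qed.

Definition proj b v : V := let w := sval (part_sumT v) in if b then w.2 else w.1.

Lemma proj_part b v : part b (proj b v).
Proof. by rewrite /proj; case: part_sumT => -[w0 w1] [/= H0 H1 _]; case: b. Qed.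

Lemma proj_sum v : v = proj false v + proj true v.
Proof. by rewrite /proj; case: part_sumT => -[w0 w1] []. Qed.

Lemma proj_uniq v0 v1 : part false v0 -> part true v1 ->
  proj false (v0 + v1) = v0 /\ proj true (v0 + v1) = v1.
Proof.
move=> H0 H1; have := proj_sum (v0 + v1); set v := v0 + v1 => e.
have E : v0 - proj false v = proj true v - v1.
  by apply/eqP; rewrite subr_eq addrAC eq_sym subr_eq addrC -e.
have Z : v0 - proj false v = 0.
  apply: part_cap; first exact: subspaceB H0 (proj_part _ _).
  by rewrite E; exact: subspaceB (proj_part _ _) H1.
split; apply/eqP; last by rewrite -subr_eq0 -E Z.
by rewrite eq_sym -subr_eq0 Z.
Qed.

Lemma proj_id b v : part b v -> proj b v = v.
Proof.
case: b => H.
  by have := (proj_uniq (subspace0 _) H).2; rewrite add0r.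
by have := (proj_uniq H (subspace0 _)).1; rewrite addr0.
Qed.

Lemma proj_other b v : part b v -> proj (~~ b) v = 0.
Proof.
case: b => H /=.
  by have := (proj_uniq (subspace0 _) H).1; rewrite add0r.
by have := (proj_uniq H (subspace0 _)).2; rewrite addr0.
Qed.

Lemma proj_linear b : linear (proj b).
Proof.
move=> k v w; rewrite {1}(proj_sum v) {1}(proj_sum w) scalerDr addrACA.
have H c := subspace_lin k (proj_part c v) (proj_part c w).
by have [E0 E1] := proj_uniq (H false) (H true); case: b.
Qed.

HB.instance Definition _ b := GRing.isLinear.Build F V V *:%R (proj b) (proj_linear b).

End Projections.

Arguments proj : simpl never.

Section FreeSuperspace.
Variables (F : numFieldType) (K : choiceType) (p : K -> bool).

Definition free_part_mem b (x : {malg F[K]}) := forall k, p k != b -> x@_k = 0.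

Lemma free_part0 b : free_part_mem b 0.
Proof. by move=> k _; rewrite mcoeff0. Qed.

Lemma free_part_lin b k x y :
  free_part_mem b x -> free_part_mem b y -> free_part_mem b (k *: x + y).
Proof. by move=> Hx Hy j H; rewrite mcoeffD mcoeffZ Hx // Hy // mulr0 addr0. Qed.

Definition free_part b := Subspace (@free_part0 b) (@free_part_lin b).

Lemma free_part_basis k : free_part (p k) << k >>.
Proof. by move=> j H; rewrite mcoeffU; case: (k =P j) H => [->|//]; rewrite eqxx. Qed.

Lemma free_part_sum x : exists x0 x1,
  [/\ free_part false x0, free_part true x1 & x = x0 + x1].
Proof.
pose P x := exists x0 x1,
  [/\ free_part false x0, free_part true x1 & x = x0 + x1].
apply: (malg_ind (P := P)).
- by exists 0, 0; split; rewrite ?addr0 //; exact: subspace0.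
- move=> k _ _ [x0 [x1 [H0 H1 ->]]] [y0 [y1 [I0 I1 ->]]].
  exists (k *: x0 + y0), (k *: x1 + y1); split; try exact: subspace_lin.
  by rewrite scalerDr addrACA.
move=> k; have := @free_part_basis k; case: (p k) => H.
  by exists 0, << k >>; split; rewrite ?add0r //; exact: subspace0.
by exists << k >>, 0; split; rewrite ?addr0 //; exact: subspace0.
Qed.

Lemma free_part_cap x : free_part false x -> free_part true x -> x = 0.
Proof.
move=> H0 H1; apply/malgP => k; rewrite mcoeff0.
by case E: (p k); [apply: H0|apply: H1]; rewrite E.
Qed.

Definition free_superspace : superspace F :=
  Superspace free_part_sum free_part_cap.

Lemma free_part_ind b (P : {malg F[K]} -> Prop) : P 0 ->
  (forall k x y, P x -> P y -> P (k *: x + y)) ->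
  (forall k, p k = b -> P << k >>) -> forall x, free_part b x -> P x.
Proof.
move=> P0 PL PB x Hx; rewrite [x]monalgE; apply: big_ind => //.
  by move=> y z Py Pz; rewrite -[y]scale1r; apply: PL.
move=> k _; have -> : << x@_k *g k >> = x@_k *: << k >> + 0 :> {malg F[K]}.
  by rewrite addr0; apply/malgP => j; rewrite mcoeffZ !mcoeffU mulrnAr mulr1.
have [/PB Pk|Hk] := eqVneq (p k) b; first exact: PL.
by rewrite Hx // scale0r addr0.
Qed.

End FreeSuperspace.

Definition ksign (F : numFieldType) (a b : bool) : F := (-1) ^+ (a && b).
Arguments ksign {F} a b.

Record lieSuperalgebra (F : numFieldType) := LieSuperalgebra {
  lie_ss :> superspace F;
  lbr : lie_ss -> lie_ss -> lie_ss;
  lbr_linl : forall z, linear (lbr ^~ z);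
  lbr_linr : forall z, linear (lbr z);
  lbr_part : forall a b x y,
    part a x -> part b y -> part (a (+) b) (lbr x y);
  lbr_anti : forall a b x y, part a x -> part b y ->
    lbr x y = - (ksign a b *: lbr y x);
  lbr_jacobi : forall a b x y z, part a x -> part b y ->
    lbr x (lbr y z) = lbr (lbr x y) z + ksign a b *: lbr y (lbr x z) }.

Record lieModule (F : numFieldType) (g : lieSuperalgebra F) := LieModule {
  mod_ss :> superspace F;
  act : g -> mod_ss -> mod_ss;
  act_linl : forall v, linear (act ^~ v);
  act_linr : forall x, linear (act x);
  act_part : forall a b x v,
    part a x -> part b v -> part (a (+) b) (act x v);
  act_lbr : forall a b x y v, part a x -> part b y ->
    act (lbr x y) v = act x (act y v) - ksign a b *: act y (act x v) }.

Section LieModuleTheory.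
Variables (F : numFieldType) (g : lieSuperalgebra F) (M : lieModule g).

HB.instance Definition _ x :=
  GRing.isLinear.Build F M M *:%R (@act F g M x) (@act_linr F g M x).

Lemma actDl x y (v : M) : act (x + y) v = act x v + act y v.
Proof. by rewrite -{1}[x]scale1r act_linl scale1r. Qed.

Lemma act0l (v : M) : act 0 v = 0.
Proof. by apply: (addrI (act 0 v)); rewrite -actDl !addr0. Qed.

Lemma actZl k x (v : M) : act (k *: x) v = k *: act x v.
Proof. by rewrite -[k *: x]addr0 act_linl act0l addr0. Qed.

End LieModuleTheory.

(** [End_g(M)]: linear endomorphisms commuting with the action of [g] (no sign),
    as an algebra under composition. *)
Section Endomorphisms.
Variables (F : numFieldType) (g : lieSuperalgebra F) (M : lieModule g).

Definition is_lie_end (f : M -> M) : Prop :=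
  linear f /\ forall (x : g) v, f (act x v) = act x (f v).

Definition lie_end_pred : {pred M -> M} := fun f => `[< is_lie_end f >].

Lemma lie_end_closed : submod_closed lie_end_pred.
Proof.
split=> [|k f h /asboolP[f_lin fE] /asboolP[h_lin hE]].
  by apply/asboolP; split=> [k u v|x v]; rewrite ?scaler0 ?addr0 ?linear0.
apply/asboolP; split=> [j u v|x v].
  rewrite !fctE f_lin h_lin !scalerDr !scalerA addrACA; congr (_ + _ + _).
  by rewrite mulrC.
by rewrite !fctE fE hE linearP.
Qed.

HB.instance Definition _ :=
  GRing.isSubmodClosed.Build F (M -> M) lie_end_pred lie_end_closed.

Definition lieEnd := {f : M -> M | f \in lie_end_pred}.
HB.instance Definition _ := SubChoice.on lieEnd.
HB.instance Definition _ := [SubChoice_isSubLmodule of lieEnd by <:].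

Lemma lieEndP (f : lieEnd) : is_lie_end (val f).
Proof. exact/asboolP/(valP f). Qed.

Lemma lie_end1_subproof : idfun \in lie_end_pred.
Proof. by apply/asboolP. Qed.

Lemma lie_end_comp_subproof (f h : lieEnd) : val f \o val h \in lie_end_pred.
Proof.
have [[f_lin fE] [h_lin hE]] := (lieEndP f, lieEndP h).
by apply/asboolP; split=> [k u v|x v] /=; rewrite ?h_lin ?f_lin // hE fE.
Qed.

Definition lieEnd1 : lieEnd := exist _ idfun lie_end1_subproof.
Definition lieEnd_comp (f h : lieEnd) : lieEnd :=
  exist _ (val f \o val h) (lie_end_comp_subproof f h).

Lemma lieEnd_compA : associative lieEnd_comp.
Proof. by move=> f h k; apply: val_inj. Qed.
Lemma lieEnd_comp1f : left_id lieEnd1 lieEnd_comp.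
Proof. by move=> f; apply: val_inj. Qed.
Lemma lieEnd_compf1 : right_id lieEnd1 lieEnd_comp.
Proof. by move=> f; apply: val_inj. Qed.
Lemma lieEnd_compDl : left_distributive lieEnd_comp +%R.
Proof. by move=> f h k; apply: val_inj. Qed.
Lemma lieEnd_compDr : right_distributive lieEnd_comp +%R.
Proof.
move=> f h k; apply: val_inj; apply/funext => v /=.
have [f_lin _] := lieEndP f.
by have := f_lin 1 (val h v) (val k v); rewrite !scale1r.
Qed.

HB.instance Definition _ := GRing.Zmodule_isPzRing.Build lieEnd
  lieEnd_compA lieEnd_comp1f lieEnd_compf1 lieEnd_compDl lieEnd_compDr.

End Endomorphisms.

(** Submodules are required to be graded. *)
Record is_submodule (F : numFieldType) (g : lieSuperalgebra F) (M : lieModule g)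
    (S : subspace M) : Prop := IsSubmodule {
  submodule_proj : forall b v, S v -> S (proj b v);
  submodule_act : forall (x : g) v, S v -> S (act x v) }.

Section Submodule.
Variables (F : numFieldType) (g : lieSuperalgebra F) (M : lieModule g).
Variables (S : subspace M) (subS : is_submodule S).

Lemma sub_lmodP (v : sub_lmod S) : S (val v).
Proof. exact/asboolP/(valP v). Qed.

Definition to_sub v (Sv : S v) : sub_lmod S := exist _ v (asboolT Sv).

Definition sub_part_mem b (v : sub_lmod S) := part b (val v).

Lemma sub_part0 b : sub_part_mem b 0.
Proof. exact: subspace0. Qed.

Lemma sub_part_lin b k v w :
  sub_part_mem b v -> sub_part_mem b w -> sub_part_mem b (k *: v + w).
Proof. exact: subspace_lin. Qed.

Definition sub_part b := Subspace (sub_part0 b) (@sub_part_lin b).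

Lemma sub_part_sum v : exists v0 v1,
  [/\ sub_part false v0, sub_part true v1 & v = v0 + v1].
Proof.
have H b := submodule_proj subS b (sub_lmodP v).
exists (to_sub (H false)), (to_sub (H true)); split; try exact: proj_part.
by apply: val_inj; exact: proj_sum.
Qed.

Lemma sub_part_cap v : sub_part false v -> sub_part true v -> v = 0.
Proof. by move=> H0 H1; apply: val_inj; exact: part_cap. Qed.

Definition sub_superspace := Superspace sub_part_sum sub_part_cap.

Definition sub_act (x : g) (v : sub_superspace) : sub_superspace :=
  to_sub (submodule_act subS x (sub_lmodP v)).

Lemma sub_act_linl v : linear (sub_act ^~ v).
Proof. by move=> k x y; apply: val_inj; exact: act_linl. Qed.

Lemma sub_act_linr x : linear (sub_act x).
Proof. by move=> k v w; apply: val_inj; exact: act_linr. Qed.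

Lemma sub_act_part a b x v :
  part a x -> part b v -> part (a (+) b) (sub_act x v).
Proof. exact: act_part. Qed.

Lemma sub_act_lbr a b x y v : part a x -> part b y ->
  sub_act (lbr x y) v
  = sub_act x (sub_act y v) - ksign a b *: sub_act y (sub_act x v).
Proof. by move=> Hx Hy; apply: val_inj; exact: act_lbr. Qed.

Definition submodule : lieModule g :=
  LieModule sub_act_linl sub_act_linr sub_act_part sub_act_lbr.

End Submodule.

Section QuotientModule.
Variables (F : numFieldType) (g : lieSuperalgebra F) (M : lieModule g).
Variables (S : subspace M) (subS : is_submodule S).

Notation pi := (quot_pi S).

Definition quot_part_mem b (q : quot_lmod S) := exists2 v, part b v & q = pi v.

Lemma quot_part0 b : quot_part_mem b 0.
Proof. by exists 0; rewrite ?quot_pi0 //; exact: subspace0. Qed.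

Lemma quot_part_lin b k q r :
  quot_part_mem b q -> quot_part_mem b r -> quot_part_mem b (k *: q + r).
Proof.
move=> [v Hv ->] [w Hw ->]; exists (k *: v + w); first exact: subspace_lin.
by rewrite linearP.
Qed.

Definition quot_part b := Subspace (quot_part0 b) (@quot_part_lin b).

Lemma quot_part_sum q : exists q0 q1,
  [/\ quot_part false q0, quot_part true q1 & q = q0 + q1].
Proof.
elim/quot_pi_ind: q => v; exists (pi (proj false v)), (pi (proj true v)).
split; last by rewrite -quot_piD -proj_sum.
- by exists (proj false v) => //; exact: proj_part.
- by exists (proj true v) => //; exact: proj_part.
Qed.

Lemma quot_part_cap q : quot_part false q -> quot_part true q -> q = 0.
Proof.
move=> [v Hv ->] [w Hw /quot_piP /(submodule_proj subS false)].
rewrite linearB /= (proj_id Hv) (proj_other (b := true) Hw) subr0.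
exact: quot_pi_eq0.
Qed.

Definition quot_superspace := Superspace quot_part_sum quot_part_cap.

Definition quot_act (x : g) : quot_superspace -> quot_superspace :=
  quot_lift (fun v => pi (act x v)).

Lemma quot_actE x v : quot_act x (pi v) = pi (act x v).
Proof.
apply: quot_liftE => [k u w|u Su]; first by rewrite !linearP.
by apply: quot_pi_eq0; apply: submodule_act.
Qed.

Lemma quot_act_linl q : linear (quot_act ^~ q).
Proof.
move=> k x y; elim/quot_pi_ind: q => v.
by rewrite !quot_actE act_linl linearP.
Qed.

Lemma quot_act_linr x : linear (quot_act x).
Proof.
move=> k; elim/quot_pi_ind => v; elim/quot_pi_ind => w.
by rewrite -linearP !quot_actE !linearP.
Qed.

Lemma quot_act_part a b x q :
  part a x -> part b q -> part (a (+) b) (quot_act x q).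
Proof.
move=> Hx [v Hv ->]; exists (act x v); last exact: quot_actE.
exact: act_part.
Qed.

Lemma quot_act_lbr a b x y q : part a x -> part b y ->
  quot_act (lbr x y) q
  = quot_act x (quot_act y q) - ksign a b *: quot_act y (quot_act x q).
Proof.
move=> Hx Hy; elim/quot_pi_ind: q => v.
by rewrite !quot_actE (act_lbr _ Hx Hy) linearB linearZ.
Qed.

Definition quotient_module : lieModule g :=
  LieModule quot_act_linl quot_act_linr quot_act_part quot_act_lbr.

End QuotientModule.

Lemma tens_act_lbr_aux (F : numFieldType) (U : lmodType F) (A B C : F)
    (p p' q r s t : U) : A * A = 1 ->
  p - A *: p' + (B * C) *: (s - A *: t)
  = p + (A * B) *: q + C *: (r + B *: s)
    - A *: (p' + (A * C) *: r + B *: (q + C *: t)).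
Proof.
move=> AA; rewrite !scalerDr !scalerN !scalerA !mulrA AA mul1r.
rewrite [C * B]mulrC [B * C * A]mulrC !mulrA.
set q' := _ *: q; set r' := _ *: r; set s' := _ *: s; set t' := _ *: t.
apply/eqP; rewrite eq_sym subr_eq [eqbRHS]addrACA [in eqbRHS](addrA (p - _)) subrK.
rewrite [q' + t']addrC [in eqbRHS](addrA (s' - t')) subrK.
by rewrite [s' + q']addrC addrACA.
Qed.

Lemma sum_bool2_only (U : zmodType) (f : bool -> bool -> U) a b :
  (forall c d, (c != a) || (d != b) -> f c d = 0) ->
  \sum_(c : bool) \sum_(d : bool) f c d = f a b.
Proof.
move=> H; rewrite (bigD1 a) //= (bigD1 b) //= big1 ?addr0 => [|d db].
  by rewrite big1 ?addr0 // => c ca; rewrite big1 // => d _; rewrite H ?ca.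
by rewrite H ?db ?orbT.
Qed.

Section KoszulSign.
Variable F : numFieldType.
Implicit Types a b c : bool.

Lemma ksignC a b : ksign a b = ksign b a :> F.
Proof. by rewrite /ksign andbC. Qed.

Lemma ksignDl a b c : ksign (a (+) b) c = ksign a c * ksign b c :> F.
Proof. by rewrite /ksign; case: a b c => -[] []; rewrite ?mulr1 ?mul1r ?mulrNN ?mulr1. Qed.

Lemma ksignDr a b c : ksign a (b (+) c) = ksign a b * ksign a c :> F.
Proof. by rewrite ksignC ksignDl !(ksignC a). Qed.

Lemma ksign_sqr a b : ksign a b * ksign a b = 1 :> F.
Proof. by rewrite /ksign -expr2 sqrr_sign. Qed.
End KoszulSign.

Section TensorSpace.
Variables (F : numFieldType) (V W : lmodType F).

Definition tens_relator (r : {malg F[(V * W)%type]}) : Prop :=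
  (exists k v v' w, r = << (k *: v + v', w) >>
                        - (k *: << (v, w) >> + << (v', w) >>)) \/
  (exists k v w w', r = << (v, k *: w + w') >>
                        - (k *: << (v, w) >> + << (v, w') >>)).

Definition tens := quot_lmod (span tens_relator).
HB.instance Definition _ := GRing.Lmodule.on tens.

Definition otimes (v : V) (w : W) : tens := quot_pi _ << (v, w) >>.

Lemma otimes_linl w : linear (otimes ^~ w).
Proof.
move=> k v v'; rewrite /otimes -linearP; apply/quot_piP; apply: span_sub.
by left; exists k, v, v', w.
Qed.

Lemma otimes_linr v : linear (otimes v).
Proof.
move=> k w w'; rewrite /otimes -linearP; apply/quot_piP; apply: span_sub.
by right; exists k, v, w, w'.
Qed.

HB.instance Definition _ v :=
  GRing.isLinear.Build F W tens *:%R (otimes v) (otimes_linr v).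

Lemma otimesDl v v' w : otimes (v + v') w = otimes v w + otimes v' w.
Proof. by have := otimes_linl w 1 v v'; rewrite !scale1r. Qed.

Lemma otimes0l w : otimes 0 w = 0.
Proof. by apply: (addrI (otimes 0 w)); rewrite -otimesDl !addr0. Qed.

Lemma otimesZl k v w : otimes (k *: v) w = k *: otimes v w.
Proof. by have := otimes_linl w k v 0; rewrite otimes0l !addr0. Qed.

Lemma otimesDr v w w' : otimes v (w + w') = otimes v w + otimes v w'.
Proof. exact: linearD. Qed.

Lemma otimesZr k v w : otimes v (k *: w) = k *: otimes v w.
Proof. exact: linearZ. Qed.

Lemma otimesBl v v' w : otimes (v - v') w = otimes v w - otimes v' w.
Proof. by rewrite -scaleN1r otimesDl otimesZl scaleN1r. Qed.

Lemma otimesBr v w w' : otimes v (w - w') = otimes v w - otimes v w'.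
Proof. exact: linearB. Qed.

Lemma otimes0r v : otimes v 0 = 0.
Proof. exact: linear0. Qed.

Lemma tens_ind (P : tens -> Prop) : P 0 ->
  (forall k s t, P s -> P t -> P (k *: s + t)) ->
  (forall v w, P (otimes v w)) -> forall t, P t.
Proof.
move=> P0 PL PB; elim/quot_pi_ind => x; move: x.
apply: (malg_ind (P := fun x => P (quot_pi _ x))).
- by rewrite quot_pi0.
- by move=> k x y Px Py; rewrite linearP; exact: PL.
- by case=> v w; exact: PB.
Qed.

Section TensorLift.
Variables (U : lmodType F) (f : V -> W -> U).
Hypothesis f_linl : forall w, linear (f ^~ w).
Hypothesis f_linr : forall v, linear (f v).

Definition tens_lift : tens -> U :=
  quot_lift (lin_ext (fun vw : V * W => f vw.1 vw.2)).

Lemma tens_lift_rel x : span tens_relator x ->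
  lin_ext (fun vw : V * W => f vw.1 vw.2) x = 0.
Proof.
apply: (span_ind (P := fun x => lin_ext _ x = 0)) => [|k y z Hy Hz|y].
- exact: linear0.
- by rewrite linearP /= Hy Hz scaler0 addr0.
case=> [[k [v [v' [w ->]]]]|[k [v [w [w' ->]]]]];
  rewrite linearB linearP /= !lin_extE /=.
- by rewrite f_linl subrr.
- by rewrite f_linr subrr.
Qed.

Lemma tens_liftE v w : tens_lift (otimes v w) = f v w.
Proof.
rewrite /tens_lift quot_liftE ?lin_extE //.
- exact: lin_ext_linear.
- exact: tens_lift_rel.
Qed.

Lemma tens_lift_linear : linear tens_lift.
Proof.
by apply: quot_lift_linear; [exact: lin_ext_linear|exact: tens_lift_rel].
Qed.

Lemma tens_lift_uniq (h : tens -> U) : linear h ->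
  (forall v w, h (otimes v w) = f v w) -> h =1 tens_lift.
Proof.
move=> h_lin hE; have h0 : h 0 = 0.
  by have := h_lin (-1) 0 0; rewrite scaler0 addr0 scaleN1r addNr.
have l0 : tens_lift 0 = 0.
  by have := tens_lift_linear (-1) 0 0; rewrite scaler0 addr0 scaleN1r addNr.
apply: tens_ind => [|k s t Hs Ht|v w]; first by rewrite h0 l0.
  by rewrite h_lin tens_lift_linear Hs Ht.
by rewrite hE tens_liftE.
Qed.
End TensorLift.

End TensorSpace.

Section TensorSuperspace.
Variables (F : numFieldType) (V W : superspace F).

Definition tens_part b : subspace (tens V W) :=
  span (fun t => exists a v w,
    [/\ part a v, part (a (+) b) w & t = otimes v w]).

Lemma tens_part_otimes a b v w : part a v -> part b w ->
  tens_part (a (+) b) (otimes (v : V) (w : W)).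
Proof.
by move=> Hv Hw; apply: span_sub; exists a, v, w; rewrite addbA addbb.
Qed.

Lemma tens_part_sum t : exists t0 t1,
  [/\ tens_part false t0, tens_part true t1 & t = t0 + t1].
Proof.
move: t; apply: (tens_ind (P := fun t => exists t0 t1,
  [/\ tens_part false t0, tens_part true t1 & t = t0 + t1])).
- by exists 0, 0; split; rewrite ?addr0 //; exact: subspace0.
- move=> k _ _ [x0 [x1 [H0 H1 ->]]] [y0 [y1 [I0 I1 ->]]].
  exists (k *: x0 + y0), (k *: x1 + y1); split; try exact: subspace_lin.
  by rewrite scalerDr addrACA.
move=> v w; have P a b := tens_part_otimes (proj_part a v) (proj_part b w).
exists (otimes (proj false v) (proj false w) + otimes (proj true v) (proj true w)).
exists (otimes (proj false v) (proj true w) + otimes (proj true v) (proj false w)).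
split.
- exact: subspaceD (P false false) (P true true).
- exact: subspaceD (P false true) (P true false).
rewrite {1}(proj_sum v) {1}(proj_sum w) otimesDl !otimesDr.
by rewrite -!addrA; congr (_ + _); rewrite addrA addrC.
Qed.

Let even_proj (t : tens V W) : tens V W :=
  tens_lift (fun v w => otimes (proj false v) (proj false w)
                        + otimes (proj true v) (proj true w)) t.

Let even_projP b t : tens_part b t -> even_proj t = if b then 0 else t.
Proof.
pose f (v : V) (w : W) := otimes (proj false v) (proj false w)
                        + otimes (proj true v) (proj true w).
have f_linl w : linear (f ^~ w).
  move=> k v v'; rewrite /f !proj_linear !otimes_linl scalerDr; exact: addrACA.
have f_linr v : linear (f v).
  move=> k w w'; rewrite /f !proj_linear !otimes_linr scalerDr; exact: addrACA.
have lin := tens_lift_linear f_linl f_linr.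
have l0 : even_proj 0 = 0.
  by have := lin (-1) 0 0; rewrite scaler0 addr0 scaleN1r addNr.
apply: (span_ind (P := fun t => even_proj t = if b then 0 else t))
  => [|k x y Hx Hy|_ [a [v [w [Hv Hw ->]]]]].
- by rewrite l0; case: b.
- have -> : even_proj (k *: x + y) = k *: even_proj x + even_proj y by exact: lin.
  by rewrite Hx Hy; case: (b) => //; rewrite scaler0 addr0.
have -> : even_proj (otimes v w) = f v w by exact: tens_liftE.
rewrite /f.
case: a b Hv Hw => -[] /= Hv Hw;
  rewrite ?(proj_id Hv) ?(proj_id Hw) (proj_other Hv) (proj_other Hw);
  by rewrite ?otimes0r ?otimes0l ?addr0 ?add0r.
Qed.

Lemma tens_part_cap t : tens_part false t -> tens_part true t -> t = 0.
Proof. by move=> /even_projP E /even_projP; rewrite E. Qed.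

Definition tens_superspace : superspace F :=
  Superspace tens_part_sum tens_part_cap.

End TensorSuperspace.

Section TensorModule.
Variables (F : numFieldType) (g : lieSuperalgebra F) (M N : lieModule g).

Notation T := (tens_superspace M N).

(** The sign rule, applied to the homogeneous components of [x] and [v]; see
    [tens_actE] for homogeneous [x] and [v]. *)
Definition tens_act_gen (x : g) (v : M) (w : N) : T :=
  otimes (act x v) w
  + \sum_(a : bool) \sum_(b : bool)
      ksign a b *: otimes (proj b v) (act (proj a x) w).

Lemma tens_act_gen_linl x w : linear (tens_act_gen x ^~ w).
Proof.
move=> k v v'; rewrite /tens_act_gen act_linr otimes_linl scalerDr addrACA; congr (_ + _).
rewrite scaler_sumr -big_split; apply: eq_bigr => a _ /=.
rewrite scaler_sumr -big_split; apply: eq_bigr => b _ /=.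
by rewrite proj_linear otimes_linl scalerDr !scalerA mulrC.
Qed.

Lemma tens_act_gen_linr x v : linear (tens_act_gen x v).
Proof.
move=> k w w'.
rewrite /tens_act_gen otimes_linr scalerDr addrACA; congr (_ + _).
rewrite scaler_sumr -big_split; apply: eq_bigr => a _ /=.
rewrite scaler_sumr -big_split; apply: eq_bigr => b _ /=.
by rewrite act_linr otimes_linr scalerDr !scalerA mulrC.
Qed.

Lemma tens_act_gen_lin v w : linear (fun x => tens_act_gen x v w).
Proof.
move=> k x y.
rewrite /tens_act_gen act_linl otimes_linl scalerDr addrACA; congr (_ + _).
rewrite scaler_sumr -big_split; apply: eq_bigr => a _ /=.
rewrite scaler_sumr -big_split; apply: eq_bigr => b _ /=.
by rewrite proj_linear act_linl otimes_linr scalerDr !scalerA mulrC.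
Qed.

Definition tens_act (x : g) : T -> T := tens_lift (tens_act_gen x).

Lemma tens_act_linr x : linear (tens_act x).
Proof.
by apply: tens_lift_linear; [exact: tens_act_gen_linl|exact: tens_act_gen_linr].
Qed.

HB.instance Definition _ x :=
  GRing.isLinear.Build F T T *:%R (tens_act x) (tens_act_linr x).

Lemma tens_act0 x : tens_act x 0 = 0.
Proof. exact: linear0. Qed.

Lemma tens_actD x s t : tens_act x (s + t) = tens_act x s + tens_act x t.
Proof. exact: linearD. Qed.

Lemma tens_actZ x k t : tens_act x (k *: t) = k *: tens_act x t.
Proof. exact: linearZ. Qed.

Lemma tens_act_otimes x v w : tens_act x (otimes v w) = tens_act_gen x v w.
Proof.
by apply: tens_liftE; [exact: tens_act_gen_linl|exact: tens_act_gen_linr].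
Qed.

Lemma tens_actE a b x v w : part a x -> part b v ->
  tens_act x (otimes v w)
  = otimes (act x v) w + ksign a b *: otimes v (act x w).
Proof.
move=> Hx Hv; rewrite tens_act_otimes /tens_act_gen; congr (_ + _).
rewrite (@sum_bool2_only _ _ a b) ?(proj_id Hx) ?(proj_id Hv) // => c d.
have [->|nca] := eqVneq c a => /=; last first.
  have -> : c = ~~ a by case: a c nca {Hx} => -[].
  by rewrite (proj_other Hx) act0l otimes0r scaler0.
move=> ndb; have -> : d = ~~ b by case: b d ndb {Hv} => -[].
by rewrite (proj_other Hv) otimes0l scaler0.
Qed.

Lemma tens_act_linl t : linear (tens_act ^~ t).
Proof.
move=> k x y; move: t; apply: (tens_ind (P := fun t =>
  tens_act (k *: x + y) t = k *: tens_act x t + tens_act y t)).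
- by rewrite !tens_act0 scaler0 addr0.
- move=> j s t Hs Ht; rewrite !tens_act_linr Hs Ht !scalerDr !scalerA.
  by rewrite [j * k]mulrC; exact: addrACA.
by move=> v w; rewrite !tens_act_otimes tens_act_gen_lin.
Qed.

Lemma tens_act_part a b x (t : T) :
  part a x -> part b t -> part (a (+) b) (tens_act x t).
Proof.
move=> Hx; move: t; apply: span_ind.
- by rewrite tens_act0; exact: subspace0.
- by move=> k s t Hs Ht; rewrite tens_act_linr; exact: subspace_lin.
move=> _ [c [v [w [Hv Hw ->]]]]; rewrite (tens_actE _ Hx Hv).
apply: subspaceD; last apply: subspaceZ.
  have := tens_part_otimes (act_part Hx Hv) Hw.
  by rewrite addbA -[a (+) c (+) c]addbA addbb addbF.
have := tens_part_otimes Hv (act_part Hx Hw).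
by rewrite addbCA addKb.
Qed.

Lemma tens_act_lbr a b x y t : part a x -> part b y ->
  tens_act (lbr x y) t
  = tens_act x (tens_act y t) - ksign a b *: tens_act y (tens_act x t).
Proof.
move=> Hx Hy; move: t; apply: (tens_ind (P := fun t => tens_act (lbr x y) t
  = tens_act x (tens_act y t) - ksign a b *: tens_act y (tens_act x t))).
- by rewrite !tens_act0 scaler0 subr0.
- move=> j s t Hs Ht; rewrite !tens_act_linr Hs Ht !scalerDr !scalerN opprD !scalerA.
  by rewrite [j * _]mulrC; exact: addrACA.
move=> v w; rewrite (proj_sum v) otimesDl !tens_actD.
suff H c u : part c u -> tens_act (lbr x y) (otimes u w)
    = tens_act x (tens_act y (otimes u w))
      - ksign a b *: tens_act y (tens_act x (otimes u w)).
  rewrite !(H _ _ (proj_part _ _)) scalerDr opprD; exact: addrACA.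
move=> Hu.
rewrite (tens_actE _ (lbr_part Hx Hy) Hu) (tens_actE _ Hx Hu) (tens_actE _ Hy Hu).
rewrite !tens_actD !tens_actZ.
rewrite !(tens_actE _ Hx (act_part Hy Hu)) !(tens_actE _ Hy (act_part Hx Hu)).
rewrite !(tens_actE _ Hx Hu) !(tens_actE _ Hy Hu) !(act_lbr _ Hx Hy).
rewrite otimesBl otimesBr otimesZl otimesZr ksignDl !ksignDr [ksign b a]ksignC.
exact/tens_act_lbr_aux/ksign_sqr.
Qed.

Definition tensor_module : lieModule g :=
  LieModule tens_act_linl tens_act_linr tens_act_part tens_act_lbr.

End TensorModule.

(** [NSL n] stands for [L_n], [NSG i] for [G_(1/2 + i)] and [NSC] for [C]. *)
Inductive ns_idx := NSL of int | NSG of int | NSC.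

Definition ns_idx_enc (k : ns_idx) : int + int + unit :=
  match k with NSL n => inl (inl n) | NSG i => inl (inr i) | NSC => inr tt end.
Definition ns_idx_dec (s : int + int + unit) : ns_idx :=
  match s with inl (inl n) => NSL n | inl (inr i) => NSG i | inr _ => NSC end.
Lemma ns_idx_encK : cancel ns_idx_enc ns_idx_dec. Proof. by case. Qed.
HB.instance Definition _ := Choice.copy ns_idx (can_type ns_idx_encK).

Definition ns_deg (k : ns_idx) : bool := if k is NSG _ then true else false.

Section NeveuSchwarz.
Variable F : numFieldType.

Definition half_int (i : int) : F := 2^-1 + i%:~R.

Definition ns_br_basis (k l : ns_idx) : {malg F[ns_idx]} :=
  match k, l with
  | NSL m, NSL n =>
      (n%:~R - m%:~R) *: << NSL (m + n) >>
      + (if m + n == 0 then (m%:~R ^+ 3 - m%:~R) / 12 else 0) *: << NSC >>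
  | NSL m, NSG i => (half_int i - m%:~R / 2) *: << NSG (m + i) >>
  | NSG i, NSL m => - ((half_int i - m%:~R / 2) *: << NSG (m + i) >>)
  | NSG i, NSG j =>
      (* 1/2 + i + (1/2 + j) = i + j + 1 *)
      2 *: << NSL (i + j + 1) >>
      - (if i + j + 1 == 0 then (half_int i ^+ 2 - 4^-1) / 3 else 0) *: << NSC >>
  | _, _ => 0
  end.

Definition ns_br := bilin_ext ns_br_basis.

Notation NSspace := (free_superspace F ns_deg).

Lemma ns_brE k l : ns_br << k >> << l >> = ns_br_basis k l.
Proof. exact: bilin_extE. Qed.

Lemma ns_br0l y : ns_br 0 y = 0.
Proof. exact: linear0. Qed.
Lemma ns_br0r x : ns_br x 0 = 0.
Proof. by have := bilin_ext_linr ns_br_basis x (-1) 0 0; rewrite scaler0 addr0 scaleN1r addNr. Qed.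
Lemma ns_brDl x x' y : ns_br (x + x') y = ns_br x y + ns_br x' y.
Proof. exact: linearD. Qed.
Lemma ns_brZl k x y : ns_br (k *: x) y = k *: ns_br x y.
Proof. exact: linearZ. Qed.
Lemma ns_brDr x y y' : ns_br x (y + y') = ns_br x y + ns_br x y'.
Proof. by have := bilin_ext_linr ns_br_basis x 1 y y'; rewrite !scale1r. Qed.
Lemma ns_brZr k x y : ns_br x (k *: y) = k *: ns_br x y.
Proof. by have := bilin_ext_linr ns_br_basis x k y 0; rewrite [bilin_ext _ x 0]ns_br0r !addr0. Qed.
Lemma ns_brNl x y : ns_br (- x) y = - ns_br x y.
Proof. exact: linearN. Qed.
Lemma ns_brNr x y : ns_br x (- y) = - ns_br x y.
Proof. by apply/eqP; rewrite -addr_eq0 -ns_brDr addNr ns_br0r. Qed.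

Definition ns_brL :=
  (ns_br0l, ns_br0r, ns_brDl, ns_brDr, ns_brNl, ns_brNr, ns_brZl, ns_brZr).

Lemma ns_br_linl z : linear (ns_br ^~ z). Proof. exact: bilin_ext_linl. Qed.
Lemma ns_br_linr z : linear (ns_br z). Proof. exact: bilin_ext_linr. Qed.

Lemma ns_basis_part k : part (s := NSspace) (ns_deg k) << k >>.
Proof. exact: free_part_basis. Qed.

Lemma ns_br_part a b (x y : NSspace) :
  part a x -> part b y -> part (s := NSspace) (a (+) b) (ns_br x y).
Proof.
move=> Hx; move: y; apply: free_part_ind => [|k y y' Hy Hy'|l <-].
- by rewrite ns_br0r; exact: subspace0.
- by rewrite ns_br_linr; exact: subspace_lin.
move: x Hx; apply: free_part_ind => [|k x x' Hx Hx'|k <-].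
- by rewrite ns_br0l; exact: subspace0.
- by rewrite ns_br_linl; exact: subspace_lin.
rewrite ns_brE; have L n := @ns_basis_part (NSL n).
have G i := @ns_basis_part (NSG i); have C := @ns_basis_part NSC.
rewrite /ns_br_basis; case: k l => [m|i|] [n|j|]; try exact: subspace0.
- by apply: (@subspaceD _ _ (part (s := NSspace) false));
  apply: (@subspaceZ _ _ (part (s := NSspace) false));
  [exact: L|exact: C].
- by apply: (@subspaceZ _ _ (part (s := NSspace) true)); exact: G.
- by apply: (@subspaceN _ _ (part (s := NSspace) true));
  apply: (@subspaceZ _ _ (part (s := NSspace) true)); exact: G.
- by apply: (@subspaceB _ _ (part (s := NSspace) false));
  apply: (@subspaceZ _ _ (part (s := NSspace) false));
  [exact: L|exact: C].
Qed.

Lemma ns_br_anti a b (x y : NSspace) : part a x -> part b y ->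
  ns_br x y = - (ksign a b *: ns_br y x).
Proof.
move=> Hx; move: y; apply: free_part_ind => [|k y y' Hy Hy'|l <-].
- by rewrite !ns_brL scaler0 oppr0.
- rewrite ns_br_linr ns_br_linl Hy Hy' !scalerDr !scalerN opprD !scalerA.
  by rewrite [k * _]mulrC.
move: x Hx; apply: free_part_ind => [|k x x' Hx Hx'|k <-].
- by rewrite !ns_brL scaler0 oppr0.
- rewrite ns_br_linr ns_br_linl Hx Hx' !scalerDr !scalerN opprD !scalerA.
  by rewrite [k * _]mulrC.
rewrite !ns_brE /ksign.
case: k l => [m|i|] [n|j|] /=; rewrite ?scaler0 ?oppr0 ?scale1r ?opprK //.
- apply/malgP => z; rewrite [n + m]addrC !(mcoeffN, mcoeffD, mcoeffZ).
  move: (_@_z) => L; move: (_@_z) => C.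
  case: eqP => [/eqP|_]; last by ring.
  by rewrite addrC addr_eq0 => /eqP ->; rewrite intrN; field.
- apply/malgP => z; rewrite [j + i]addrC !(mcoeffN, mcoeffD, mcoeffZ).
  move: (_@_z) => L; move: (_@_z) => C.
  case: eqP => [E|_]; last by ring.
  have -> : j = - 1 - i by lia.
  by rewrite /half_int intrB intrN; field.
Qed.

Lemma ns_brCl y : ns_br << NSC >> y = 0.
Proof.
move: y; apply: (malg_ind (P := fun y => ns_br << NSC >> y = 0)).
- exact: ns_br0r.
- by move=> k y z Hy Hz; rewrite ns_br_linr Hy Hz scaler0 addr0.
- by move=> l; rewrite ns_brE.
Qed.

Lemma ns_brCr x : ns_br x << NSC >> = 0.
Proof.
move: x; apply: (malg_ind (P := fun x => ns_br x << NSC >> = 0)).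
- exact: ns_br0l.
- by move=> k y z Hy Hz; rewrite ns_br_linl Hy Hz scaler0 addr0.
- by move=> l; rewrite ns_brE; case: l.
Qed.

(** Away from [C], [[<<k>>, <<l>>] = ns_c k l *: << ns_i k l >> + ns_z k l *: C]. *)
Definition ns_i k l := match k, l with
  | NSL m, NSL n => NSL (m + n)
  | NSL m, NSG i => NSG (m + i)
  | NSG i, NSL m => NSG (m + i)
  | NSG i, NSG j => NSL (i + j + 1)
  | _, _ => NSC end.

Definition ns_c k l : F := match k, l with
  | NSL m, NSL n => n%:~R - m%:~R
  | NSL m, NSG i => half_int i - m%:~R / 2
  | NSG i, NSL m => - (half_int i - m%:~R / 2)
  | NSG i, NSG j => 2
  | _, _ => 0 end.

Definition ns_z k l : F := match k, l with
  | NSL m, NSL n => if m + n == 0 then (m%:~R ^+ 3 - m%:~R) / 12 else 0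
  | NSG i, NSG j =>
      - (if i + j + 1 == 0 then (half_int i ^+ 2 - 4^-1) / 3 else 0)
  | _, _ => 0 end.

Lemma ns_br_basisE k l :
  ns_br << k >> << l >> = ns_c k l *: << ns_i k l >> + ns_z k l *: << NSC >>.
Proof.
rewrite ns_brE.
by case: k l => [m|i|] [n|j|] /=; rewrite ?scaleNr ?scale0r ?addr0.
Qed.

Lemma ns_br_nestr k l n : ns_br << k >> (ns_br << l >> << n >>)
  = (ns_c l n * ns_c k (ns_i l n)) *: << ns_i k (ns_i l n) >>
    + (ns_c l n * ns_z k (ns_i l n)) *: << NSC >>.
Proof.
rewrite [ns_br << l >> _]ns_br_basisE ns_br_linr ns_brZr ns_brCr scaler0 addr0.
by rewrite ns_br_basisE scalerDr !scalerA.
Qed.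

Lemma ns_br_nestl k l n : ns_br (ns_br << k >> << l >>) << n >>
  = (ns_c k l * ns_c (ns_i k l) n) *: << ns_i (ns_i k l) n >>
    + (ns_c k l * ns_z (ns_i k l) n) *: << NSC >>.
Proof.
rewrite [ns_br << k >> _]ns_br_basisE ns_br_linl ns_brZl ns_brCl scaler0 addr0.
by rewrite ns_br_basisE scalerDr !scalerA.
Qed.

Lemma ns_jacobi_scalars k l n : [/\ k <> NSC, l <> NSC & n <> NSC] ->
  [/\ ns_i (ns_i k l) n = ns_i k (ns_i l n),
      ns_i l (ns_i k n) = ns_i k (ns_i l n),
      ns_c l n * ns_c k (ns_i l n) = ns_c k l * ns_c (ns_i k l) n
        + ksign (ns_deg k) (ns_deg l) * (ns_c k n * ns_c l (ns_i k n)) &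
      ns_c l n * ns_z k (ns_i l n) = ns_c k l * ns_z (ns_i k l) n
        + ksign (ns_deg k) (ns_deg l) * (ns_c k n * ns_z l (ns_i k n))].
Proof.
case: k l n => [m|i|] [n|j|] [p|k|] [] // _ _ _; rewrite /ksign /= ?expr0 ?expr1;
  split; try (by congr NSL; lia); try (by congr NSG; lia);
  try (by rewrite /half_int ?(intrD, rmorph1); field); try ring;
  repeat (case: eqP => ?; try (exfalso; lia)); rewrite ?(oppr0, mulr0, addr0) //.
- have -> : p = - m - n by lia.
  by rewrite !(intrD, intrN); field.
- have -> : k = - m - j - 1 by lia.
  by rewrite /half_int !(intrD, intrN, rmorph1); field.
- have -> : k = - n - i - 1 by lia.
  by rewrite /half_int !(intrD, intrN, rmorph1); field.
- have -> : p = - i - j - 1 by lia.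
  by rewrite /half_int !(intrD, intrN, rmorph1); field.
Qed.

Lemma ns_br_jacobi a b (x y z : NSspace) : part a x -> part b y ->
  ns_br x (ns_br y z) = ns_br (ns_br x y) z + ksign a b *: ns_br y (ns_br x z).
Proof.
have lin_step (U : lmodType F) (e k : F) (s t s1 t1 s2 t2 : U) :
    s = s1 + e *: s2 -> t = t1 + e *: t2 ->
    k *: s + t = k *: s1 + t1 + e *: (k *: s2 + t2).
  by move=> -> ->; rewrite !scalerDr !scalerA [e * k]mulrC; exact: addrACA.
move=> Hx Hy; move: z; apply: (malg_ind (P := fun z => ns_br x (ns_br y z)
  = ns_br (ns_br x y) z + ksign a b *: ns_br y (ns_br x z))).
- by rewrite !(ns_br0r, scaler0, addr0).
- by move=> k z z' Hz Hz'; rewrite !ns_br_linr; exact: lin_step.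
move=> n; move: y Hy; apply: free_part_ind => [|k y y' Hy Hy'|l <-].
- by rewrite !(ns_br0r, ns_br0l, scaler0, addr0).
- by rewrite !(ns_br_linr, ns_br_linl); exact: lin_step.
move: x Hx; apply: free_part_ind => [|k x x' Hx Hx'|k <-].
- by rewrite !(ns_br0r, ns_br0l, scaler0, addr0).
- by rewrite !(ns_br_linr, ns_br_linl); exact: lin_step.
have [->|/eqP k_C] := eqVneq k NSC.
  by rewrite !(ns_brCl, ns_br0r, ns_br0l, scaler0, addr0).
have [->|/eqP l_C] := eqVneq l NSC.
  by rewrite !(ns_brCl, ns_brCr, ns_br0r, ns_br0l, scaler0, addr0).
have [->|/eqP n_C] := eqVneq n NSC.
  by rewrite !(ns_brCr, ns_br0r, scaler0, addr0).
have [Ei1 Ei2 Ec Ez] := ns_jacobi_scalars (And3 k_C l_C n_C).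
rewrite !ns_br_nestr ns_br_nestl Ei1 Ei2 Ec Ez scalerDr !scalerA !scalerDl.
exact: addrACA.
Qed.

Definition NS : lieSuperalgebra F :=
  @LieSuperalgebra F NSspace ns_br
    ns_br_linl ns_br_linr ns_br_part ns_br_anti ns_br_jacobi.

Definition nsL (n : int) : NS := << NSL n >>.
(** [nsG i] is [G_(1/2 + i)]. *)
Definition nsG (i : int) : NS := << NSG i >>.
Definition nsC : NS := << NSC >>.

Definition n_plus : subspace NS :=
  span (fun x => (exists2 i : int, 0 < i & x = nsL i) \/
                 (exists2 i : int, 0 < half_int i & x = nsG i)).

Definition generated_by (M : lieModule NS) (u : M) : Prop :=
  forall S : subspace M, is_submodule S -> S u -> forall v, S v.

Record highest_weight (c h : F) (M : lieModule NS) (u : M) : Prop :=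
  HighestWeight {
    hw_neq0 : u <> 0;
    hw_even : part false u;
    hw_n_plus : forall x, n_plus x -> act x u = 0;
    hw_L0 : act (nsL 0) u = h *: u;
    hw_C : act nsC u = c *: u;
    hw_gen : generated_by u }.

End NeveuSchwarz.

(** [SAx j] stands for [x_j] and [SAy j] for [y_(1/2 + j)]. *)
Inductive sa_idx := SAx of int | SAy of int.

Definition sa_idx_enc (k : sa_idx) : int + int :=
  match k with SAx j => inl j | SAy j => inr j end.
Definition sa_idx_dec (s : int + int) : sa_idx :=
  match s with inl j => SAx j | inr j => SAy j end.
Lemma sa_idx_encK : cancel sa_idx_enc sa_idx_dec. Proof. by case. Qed.
HB.instance Definition _ := Choice.copy sa_idx (can_type sa_idx_encK).

Definition sa_deg (k : sa_idx) : bool := if k is SAy _ then true else false.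

Section IntermediateSeries.
Variable F : numFieldType.
Variables a b : F.

Definition sa_act_basis (g : ns_idx) (k : sa_idx) : {malg F[sa_idx]} :=
  match g, k with
  | NSL i, SAx j => (a + j%:~R + i%:~R * b) *: << SAx (i + j) >>
  | NSL i, SAy j => (a + half_int F j + i%:~R * (b - 2^-1)) *: << SAy (i + j) >>
  | NSG i, SAx j => << SAy (i + j) >>
  | NSG i, SAy j =>
      (a + half_int F j + 2 * half_int F i * (b - 2^-1)) *: << SAx (1 + i + j) >>
  | NSC, _ => 0
  end.

Notation SAspace := (free_superspace F sa_deg).

Definition sa_act (x : NS F) (v : SAspace) : SAspace :=
  bilin_ext sa_act_basis x v.

Lemma sa_actE g k : sa_act << g >> << k >> = sa_act_basis g k.
Proof. exact: bilin_extE. Qed.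

Lemma sa_act_linl v : linear (sa_act ^~ v). Proof. exact: bilin_ext_linl. Qed.
Lemma sa_act_linr x : linear (sa_act x). Proof. exact: bilin_ext_linr. Qed.

Lemma sa_act0l v : sa_act 0 v = 0. Proof. exact: linear0. Qed.
Lemma sa_act0r x : sa_act x 0 = 0.
Proof. by have := sa_act_linr x (-1) 0 0; rewrite scaler0 addr0 scaleN1r addNr. Qed.
Lemma sa_actZl k x v : sa_act (k *: x) v = k *: sa_act x v.
Proof. exact: linearZ. Qed.
Lemma sa_actZr k x v : sa_act x (k *: v) = k *: sa_act x v.
Proof. by have := sa_act_linr x k v 0; rewrite sa_act0r !addr0. Qed.

Lemma sa_basis_part k : part (s := SAspace) (sa_deg k) << k >>.
Proof. exact: free_part_basis. Qed.

Lemma sa_act_part p q x v :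
  part p x -> part q v -> part (p (+) q) (sa_act x v).
Proof.
move=> Hx; move: v; apply: free_part_ind => [|k v w Hv Hw|l <-].
- by rewrite sa_act0r; exact: subspace0.
- by rewrite sa_act_linr; exact: subspace_lin.
move: x Hx; apply: free_part_ind => [|k x y Hx Hy|k <-].
- by rewrite sa_act0l; exact: subspace0.
- by rewrite sa_act_linl; exact: subspace_lin.
rewrite sa_actE /sa_act_basis; have X j := @sa_basis_part (SAx j).
have Y j := @sa_basis_part (SAy j).
case: k l => [i|i|] [j|j]; try exact: subspace0; try exact: Y.
- by apply: (@subspaceZ _ _ (part (s := SAspace) false)); exact: X.
- by apply: (@subspaceZ _ _ (part (s := SAspace) true)); exact: Y.
- by apply: (@subspaceZ _ _ (part (s := SAspace) false)); exact: X.
Qed.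

Definition sa_i (g : ns_idx) (k : sa_idx) : sa_idx :=
  match g, k with
  | NSL i, SAx j => SAx (i + j)
  | NSL i, SAy j => SAy (i + j)
  | NSG i, SAx j => SAy (i + j)
  | NSG i, SAy j => SAx (1 + i + j)
  | NSC, _ => k
  end.

Definition sa_c (g : ns_idx) (k : sa_idx) : F :=
  match g, k with
  | NSL i, SAx j => a + j%:~R + i%:~R * b
  | NSL i, SAy j => a + half_int F j + i%:~R * (b - 2^-1)
  | NSG i, SAx j => 1
  | NSG i, SAy j => a + half_int F j + 2 * half_int F i * (b - 2^-1)
  | NSC, _ => 0
  end.

Lemma sa_act_basisE g k : sa_act << g >> << k >> = sa_c g k *: << sa_i g k >>.
Proof. by rewrite sa_actE; case: g k => [i|i|] [j|j] /=; rewrite ?scale1r ?scale0r. Qed.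

Lemma sa_act_lbr_basis g l k : sa_act (ns_br << g >> << l >>) << k >>
  = sa_act << g >> (sa_act << l >> << k >>)
    - ksign (ns_deg g) (ns_deg l) *: sa_act << l >> (sa_act << g >> << k >>).
Proof.
have actC v : sa_act << NSC >> << v >> = 0 by rewrite sa_actE.
rewrite ns_br_basisE sa_act_linl [sa_act (_ *: << NSC >>) _]sa_actZl actC.
rewrite scaler0 addr0 !sa_act_basisE !sa_actZr !sa_act_basisE !scalerA.
have [Cg|/eqP nCg] := eqVneq g NSC.
  by rewrite Cg /= !(mul0r, mulr0, scale0r, subr0).
have [Cl|/eqP nCl] := eqVneq l NSC.
  by rewrite Cl /=; case: (g) => [?|?|]; rewrite /= !(mul0r, mulr0, scale0r, subr0).
have [E1 E2 E] : [/\ sa_i (ns_i g l) k = sa_i g (sa_i l k),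
    sa_i l (sa_i g k) = sa_i g (sa_i l k) &
    ns_c F g l * sa_c (ns_i g l) k = sa_c l k * sa_c g (sa_i l k)
      - ksign (ns_deg g) (ns_deg l) * sa_c g k * sa_c l (sa_i g k)].
  case: g l k nCg nCl => [m|m|] [n|n|] [j|j] // _ _; rewrite /ksign /= ?expr0 ?expr1;
    split; try (by congr SAx; lia); try (by congr SAy; lia);
    by rewrite /half_int ?(intrD, rmorph1); field.
by rewrite E scalerBl E1 E2.
Qed.

Lemma sa_act_lbr p q x y v : part p x -> part q y ->
  sa_act (lbr x y) v
  = sa_act x (sa_act y v) - ksign p q *: sa_act y (sa_act x v).
Proof.
have lin_step (U : lmodType F) (e k : F) (s t s1 t1 s2 t2 : U) :
    s = s1 - e *: s2 -> t = t1 - e *: t2 ->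
    k *: s + t = k *: s1 + t1 - e *: (k *: s2 + t2).
  move=> -> ->; rewrite !scalerDr !scalerN !scalerA [e * k]mulrC opprD.
  exact: addrACA.
move=> Hx Hy; move: v; apply: (malg_ind (P := fun v => sa_act (lbr x y) v
  = sa_act x (sa_act y v) - ksign p q *: sa_act y (sa_act x v))).
- by rewrite !sa_act0r scaler0 subr0.
- by move=> k v w Hv Hw; rewrite !sa_act_linr; exact: lin_step.
move=> k; move: y Hy; apply: free_part_ind => [|j y z Hy Hz|l <-].
- by rewrite [lbr x 0]ns_br0r !(sa_act0l, sa_act0r) scaler0 subr0.
- by rewrite lbr_linr !(sa_act_linl, sa_act_linr); exact: lin_step.
move: x Hx; apply: free_part_ind => [|j x z Hx Hz|g <-].
- by rewrite [lbr 0 _]ns_br0l !(sa_act0l, sa_act0r) scaler0 subr0.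
- by rewrite lbr_linl !(sa_act_linl, sa_act_linr); exact: lin_step.
exact: sa_act_lbr_basis.
Qed.

Definition SA : lieModule (NS F) :=
  @LieModule F (NS F) SAspace sa_act sa_act_linl sa_act_linr sa_act_part sa_act_lbr.

Definition sa_x (j : int) : SA := << SAx j >>.
(** [sa_y j] is [y_(1/2 + j)]. *)
Definition sa_y (j : int) : SA := << SAy j >>.

(** The span of all [y_(1/2 + j)] and of all [x_j] with [j <> - a]. *)
Definition sa_sub : subspace SA :=
  span (fun v => (exists j, v = sa_y j) \/
                 (exists2 j : int, j%:~R <> - a & v = sa_x j)).

(** The line [F y_(-a)] when [a] is in [1/2 + Z]. *)
Definition sa_ker : subspace SA :=
  span (fun v => exists2 j : int, half_int F j = - a & v = sa_y j).

Definition sa_sub_case : Prop := (exists n : int, a = n%:~R) /\ b = 1.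
Definition sa_quot_case : Prop := (exists n : int, a = half_int F n) /\ b = 2^-1.

Lemma span_submodule (A : SA -> Prop) :
  (forall v, A v -> exists p, part p v) ->
  (forall g v, A v -> span A (sa_act << g >> v)) ->
  is_submodule (span A).
Proof.
move=> A_hom A_act; split.
  move=> p; apply: span_ind => [|k v w Hv Hw|v Av].
  - by rewrite linear0; exact: subspace0.
  - by rewrite proj_linear; exact: subspace_lin.
  have [q Hv] := A_hom v Av.
  have [->|npq] := eqVneq p q; first by rewrite (proj_id Hv); exact: span_sub.
  have -> : p = ~~ q by case: p q npq {Hv} => -[].
  by rewrite (proj_other Hv); exact: subspace0.
move=> x; apply: span_ind => [|k v w Hv Hw|v Av].
- by rewrite linear0; exact: subspace0.
- by rewrite act_linr; exact: subspace_lin.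
move: x; apply: (malg_ind (P := fun x : NS F => span A (act x v))).
- by rewrite act0l; exact: subspace0.
- by move=> k x y Hx Hy; rewrite act_linl; exact: subspace_lin.
by move=> g; exact: A_act.
Qed.

Lemma sa_sub_submodule : sa_sub_case -> is_submodule sa_sub.
Proof.
move=> [_ b1]; apply: span_submodule => [v [[j ->]|[j _ ->]]|g v Av].
- by exists true; exact: (@sa_basis_part (SAy j)).
- by exists false; exact: (@sa_basis_part (SAx j)).
have Y j : sa_sub (sa_y j) by apply: span_sub; left; exists j.
have X c j : (c <> 0 -> j%:~R <> - a) -> sa_sub (c *: sa_x j).
  have [->|/eqP c0] := eqVneq c 0; first by rewrite scale0r => _; exact: subspace0.
  by move=> /(_ c0) H; apply: subspaceZ; apply: span_sub; right; exists j.
case: Av => [[j ->]|[j ja ->]]; rewrite sa_actE; case: g => [i|i|].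
- exact: subspaceZ (Y (i + j)).
- apply: (X _ (1 + i + j)) => c0 E; apply: c0; rewrite b1.
  move: E => /eqP; rewrite -addr_eq0 /half_int !(intrD, rmorph1) => /eqP E.
  by rewrite -[RHS]E; field.
- exact: subspace0.
- apply: (X _ (i + j)) => c0 E; apply: c0; rewrite b1.
  move: E => /eqP; rewrite -addr_eq0 intrD => /eqP E.
  by rewrite -[RHS]E; ring.
- exact: Y (i + j).
- exact: subspace0.
Qed.

Lemma sa_ker_submodule : sa_quot_case -> is_submodule sa_ker.
Proof.
move=> [_ b1]; apply: span_submodule => [v [j _ ->]|g v [j ja ->]].
  by exists true; exact: (@sa_basis_part (SAy j)).
rewrite sa_actE /sa_act_basis; case: g => [i|i|]; last exact: subspace0.
- by rewrite ja subrr add0r b1 subrr mulr0 scale0r; exact: subspace0.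
- by rewrite ja subrr add0r b1 subrr mulr0 scale0r; exact: subspace0.
Qed.

Definition SA' : lieModule (NS F) :=
  match pselect sa_sub_case with
  | left H => submodule (sa_sub_submodule H)
  | right _ =>
      match pselect sa_quot_case with
      | left H => quotient_module (sa_ker_submodule H)
      | right _ => SA
      end
  end.

End IntermediateSeries.

(* Main.v *)
From HB Require Import structures.
Require Import Defs.
From mathcomp Require Import all_boot all_order all_algebra.
From mathcomp Require Import boolp reals complex.
From mathcomp Require Import finmap monalg.
From mathcomp Require Import ring zify.

(** Let f commute with NS on V ⊗ SA'. Every vector of V is killed by all L_n and
    G_r of large index, so products of two such elements act on f(u ⊗ w), for a
    basis vector w of SA', through the second factor only. Comparing two products
    of the same degree whose coefficients separate w from another basis vector w'
    shows that w' does not occur in f(u ⊗ w); hence f(u ⊗ w) = v ⊗ w for some v. Since v has weight h and that weight space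
    of V is a line, v = r u. The scalar r does not depend on w because raising
    operators kill u and connect any two basis vectors to a common one, and u
    generates V, so f = r. *)

Set Implicit Arguments.
Unset Strict Implicit.
Unset Printing Implicit Defensive.

Import Order.TTheory GRing.Theory Num.Theory.
Local Open Scope ring_scope.
Local Notation span := Defs.span.

(** * Separating basis vectors of SA *)

Lemma affine_neq0 (F : numFieldType) (x y : F) :
  (x != 0) || (y != 0) -> exists m : nat, x + m%:R * y != 0.
Proof.
have [->|x0 _] := eqVneq x 0; last by exists 0%N; rewrite mul0r addr0.
by move=> y0; exists 1%N; rewrite add0r mul1r.
Qed.

(** Each sum vanishes for at most one [m], so one of 0, 1, 2 avoids both roots. *)
Lemma shift2_neq0 (F : numFieldType) (x y : F) :
  exists2 m : nat, x + m%:R != 0 & y + m%:R != 0.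
Proof.
have bad (z : F) (m n : nat) : z + m%:R = 0 -> m != n -> z + n%:R != 0.
  by move=> /eqP; rewrite addr_eq0 => /eqP ->; rewrite addrC subr_eq0 eqr_nat eq_sym.
have [x0|x0] := eqVneq (x + 0%:R) 0; have [y0|y0] := eqVneq (y + 0%:R) 0.
- by exists 1%N; apply: (@bad _ 0%N).
- have [y1|y1] := eqVneq (y + 1%:R) 0; last by exists 1%N => //; apply: (@bad _ 0%N).
  by exists 2%N; [apply: (@bad _ 0%N)|apply: (@bad _ 1%N)].
- have [x1|x1] := eqVneq (x + 1%:R) 0; last by exists 1%N => //; apply: (@bad _ 0%N).
  by exists 2%N; [apply: (@bad _ 1%N)|apply: (@bad _ 0%N)].
by exists 0%N.
Qed.

(** [C] is excluded: only the elements that kill a given vector of a highest weight module for large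
    [N] are meant. *)
Definition ns_ge (N : nat) (g : ns_idx) : bool :=
  match g with NSL n => N%:Z <= n | NSG i => N%:Z <= i | NSC => false end.

Lemma ns_ge_leq N N' g : (N <= N')%N -> ns_ge N' g -> ns_ge N g.
Proof. by case: g => [n|i|] //=; lia. Qed.

Section Separation.
Variables (F : numFieldType) (a b : F).

Definition sa_c2 g g' k := sa_c a b g' k * sa_c a b g (sa_i g' k).

(* At [b = 1/2] the excluded vector [y_(-a)] is killed by [NS]. *)
Definition sa_live (k : sa_idx) : bool :=
  if k is SAy j then (b == 2^-1) ==> (a + half_int F j != 0) else true.

Lemma half_int_eq (i j : int) : (half_int F i == half_int F j) = (i == j).
Proof. by rewrite /half_int (inj_eq (addrI _)) eqr_int. Qed.

(* Some combination of [g g'] and [d d'] kills the basis vector [k] but not [l]. *)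
Definition separated (N : nat) (k l : sa_idx) : Prop :=
  exists g g' d d', [/\ ns_ge N g, ns_ge N g', ns_ge N d, ns_ge N d' &
  [/\ ns_deg g = ns_deg g', ns_deg d = ns_deg d',
      forall n, sa_i g (sa_i g' n) = sa_i d (sa_i d' n) &
      sa_c2 g g' k * sa_c2 d d' l != sa_c2 d d' k * sa_c2 g g' l]].

(** The products [T (N+m+1) T N] and [T (N+m) T (N+1)] have the same degree; this is the 2 by 2
    determinant of their coefficients on [k] and [l]. *)
Definition sep_det (T : int -> ns_idx) (N m : nat) (k l : sa_idx) : F :=
  sa_c2 (T (N + m + 1)%:Z) (T N%:Z) k * sa_c2 (T (N + m)%:Z) (T (N + 1)%:Z) l
  - sa_c2 (T (N + m)%:Z) (T (N + 1)%:Z) k * sa_c2 (T (N + m + 1)%:Z) (T N%:Z) l.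

Lemma separated_det T N m k l : T = NSG \/ T = NSL ->
  sep_det T N m k l != 0 -> separated N k l.
Proof.
move=> HT; rewrite subr_eq0 => H.
exists (T (N + m + 1)%:Z), (T N%:Z), (T (N + m)%:Z), (T (N + 1)%:Z).
by case: HT H => -> H; split=> /=; try lia; split=> // -[j|j] /=; congr (_ _); lia.
Qed.

(* Products of two [G]'s separate two [x]'s unless [b = 1], two [y]'s unless
   [b = 1/2], and an [x] from a [y] always; products of two [L]'s settle the
   remaining cases. *)
Lemma separation k l (N : nat) :
  k != l -> sa_live k -> sa_live l -> separated N k l.
Proof.
have b2 (x : F) : b != x -> 2 * b - 2 * x != 0.
  by move=> bx; rewrite -mulrBr mulf_neq0 ?pnatr_eq0 // subr_eq0.
(* Up to sign, the determinant of an [x_i] and a [y_j] for products of [G]'s. It is affine in [m]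
   with slope [(2b - 1)^2]; at [b = 1/2] it equals [-(a + half_int F j)]. *)
have mixed i j : (b == 2^-1) ==> (a + half_int F j != 0) ->
  exists m : nat,
    (2 * b - 1) * (a + i%:~R + (2 * N%:R + m%:R + 2) * (2 * b - 1))
    - (2 - 2 * b) * (a + half_int F j) != 0.
  move=> Hj; set y := a + half_int F j.
  have : ((2 * b - 1) * (a + i%:~R + (2 * N%:R + 2) * (2 * b - 1))
            - (2 - 2 * b) * y != 0) || ((2 * b - 1) ^+ 2 != 0).
    have [bE|/b2] := eqVneq b 2^-1; last first.
      by rewrite divff ?pnatr_eq0 // => b2n; rewrite orbC expf_neq0.
    move: Hj; rewrite -/y bE eqxx /= => y0; apply/orP; left.
    by rewrite (_ : _ - _ = - y) ?oppr_eq0 //; field.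
  move=> /affine_neq0[m Hm]; exists m.
  by apply: contra Hm => /eqP E; apply/eqP; rewrite -[RHS]E; ring.
have nz (x y : F) : x != 0 -> y = x -> y != 0 by move=> ? ->.
have G : NSG = NSG \/ NSG = NSL by left.
have L : NSL = NSG \/ NSL = NSL by right.
case: k l => [i|i] [j|j] kl lk ll.
- have ij : (i%:~R - j%:~R : F) != 0.
    by rewrite subr_eq0 eqr_int; apply: contra kl => /eqP ->.
  have [b1|/b2 b2n] := eqVneq b 1.
    (* At [b = 1] the determinant for products of [L]'s is [i - j] times these two sums shifted by
       [m]. *)
    have [m Hx Hy] := @shift2_neq0 F (a + i%:~R + 2 * N%:R + 1)
                                     (a + j%:~R + 2 * N%:R + 1).
    apply: (separated_det (m := m) L).
    apply: nz (mulf_neq0 ij (mulf_neq0 Hx Hy)) _.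
    by rewrite /sep_det /sa_c2 /= b1 !(intrD, rmorph1, pmulrn); ring.
  apply: (separated_det (m := 0) G).
  rewrite (_ : sep_det _ _ _ _ _ = - ((2 * b - 2 * 1) * (i%:~R - j%:~R))).
    by rewrite oppr_eq0 mulf_neq0.
  by rewrite /sep_det /sa_c2 /= /half_int !(intrD, rmorph1, pmulrn, PoszD); field.
- have [m Hm] := mixed i j ll; apply: (separated_det (m := m) G).
  apply: nz Hm _.
  by rewrite /sep_det /sa_c2 /= /half_int !(intrD, rmorph1, pmulrn, PoszD); field.
- have [m Hm] := mixed j i lk; apply: (separated_det (m := m) G).
  rewrite -oppr_eq0; apply: nz Hm _.
  by rewrite /sep_det /sa_c2 /= /half_int !(intrD, rmorph1, pmulrn, PoszD); field.
have ij : (i%:~R - j%:~R : F) != 0.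
  by rewrite subr_eq0 eqr_int; apply: contra kl => /eqP ->.
(* At [b = 1/2] the determinant for products of [L]'s is [i - j] times [a + half_int F i] and
   [a + half_int F j], both nonzero by [sa_live]. *)
have [bh|/b2] := eqVneq b 2^-1; last rewrite divff ?pnatr_eq0 // => b2n.
  move: lk ll; rewrite /= bh eqxx /= => Hi Hj.
  apply: (separated_det (m := 0) L).
  apply: nz (mulf_neq0 ij (mulf_neq0 Hi Hj)) _.
  by rewrite /sep_det /sa_c2 /= bh /half_int !(intrD, rmorph1, pmulrn); field.
apply: (separated_det (m := 0) G).
apply: nz (mulf_neq0 b2n ij) _.
by rewrite /sep_det /sa_c2 /= /half_int !(intrD, rmorph1, pmulrn, PoszD); field.
Qed.
End Separation.

(** * Highest weight modules *)

Lemma actDr (F : numFieldType) (g : lieSuperalgebra F) (M : lieModule g) x (v w : M) :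
  act x (v + w) = act x v + act x w.
Proof. by have := act_linr x 1 v w; rewrite !scale1r. Qed.

Lemma act0r (F : numFieldType) (g : lieSuperalgebra F) (M : lieModule g) x :
  act x (0 : M) = 0.
Proof. by have := act_linr x (-1) (0 : M) 0; rewrite scaler0 addr0 scaleN1r addNr. Qed.

Lemma actZr (F : numFieldType) (g : lieSuperalgebra F) (M : lieModule g) x k (v : M) :
  act x (k *: v) = k *: act x v.
Proof. by have := act_linr x k v 0; rewrite act0r !addr0. Qed.

Lemma bas_part (F : numFieldType) g : part (ns_deg g) (<< g >> : NS F).
Proof. exact: ns_basis_part. Qed.
Arguments bas_part F g : clear implicits.

Lemma act_proj (F : numFieldType) (g : lieSuperalgebra F)
    (M : lieModule g) p q (x : g) (v : M) :
  part p x -> act x (proj q v) = proj (p (+) q) (act x v).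
Proof.
move=> Hx; rewrite {2}(proj_sum v) actDr linearD /=.
have H r := act_part Hx (proj_part r v).
have [E0 E1] : proj (p (+) q) (act x (proj q v)) = act x (proj q v) /\
               proj (p (+) q) (act x (proj (~~ q) v)) = 0.
  split; first exact: proj_id.
  by have := proj_other (H (~~ q)); rewrite addbN negbK.
by case: q E0 E1 => /= -> ->; rewrite ?add0r ?addr0.
Qed.

Section HighestWeight.
Variables (F : numFieldType).

Notation bas k := (<< k >> : NS F).

(** * Vectors killed by all elements of large index *)

Section Module.
Variable V : lieModule (NS F).
Implicit Types (v : V).

Lemma act_bas_ind (S : subspace V) v :
  (forall g, S (act (bas g) v)) -> forall x : NS F, S (act x v).
Proof.
move=> H; apply: (malg_ind (P := fun x : NS F => S (act x v))) => //.
- by rewrite act0l; exact: subspace0.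
- by move=> k x y Hx Hy; rewrite act_linl; exact: subspace_lin.
Qed.

Lemma act_bas_comm g d v : act (bas g) (act (bas d) v)
  = ns_c F g d *: act (bas (ns_i g d)) v + ns_z F g d *: act (bas NSC) v
    + ksign (ns_deg g) (ns_deg d) *: act (bas d) (act (bas g) v).
Proof.
have := act_lbr v (bas_part F g) (bas_part F d).
rewrite [lbr _ _]ns_br_basisE actDl !actZl => ->.
by rewrite subrK.
Qed.

(** Modules all of whose vectors satisfy this are known as restricted, or smooth. *)
Definition ns_nilpotent v :=
  exists N : nat, forall g, ns_ge N g -> act (bas g) v = 0.

Lemma ns_nilpotent0 : ns_nilpotent 0.
Proof. by exists 0%N => g _; rewrite linear0. Qed.

Lemma ns_nilpotent_lin k v w :
  ns_nilpotent v -> ns_nilpotent w -> ns_nilpotent (k *: v + w).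
Proof.
move=> [N HN] [N' HN']; exists (maxn N N') => g Hg.
rewrite linearP /= HN ?HN' ?scaler0 ?addr0 //.
- exact: ns_ge_leq (leq_maxr _ _) Hg.
- exact: ns_ge_leq (leq_maxl _ _) Hg.
Qed.

Definition ns_nil := Subspace ns_nilpotent0 ns_nilpotent_lin.

Lemma ns_nil_submodule : is_submodule ns_nil.
Proof.
split=> [q v [N HN]|x v [N HN]].
  by exists N => g Hg; rewrite (act_proj _ _ (bas_part F g)) HN // linear0.
apply: act_bas_ind => d.
pose s : int := match d with NSL n => n | NSG n => n | NSC => 0 end.
(* With this bound the index of [[g, d]] is still at least [N]; the extra 1 makes the total degree
   positive, so no central term appears. *)
exists (N + `|s| + 1)%N => g Hg.
have Hg' : ns_ge N g by apply: ns_ge_leq Hg; rewrite -addnA leq_addr.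
rewrite act_bas_comm [act (bas g) v]HN // linear0 scaler0 addr0.
have -> : ns_z F g d = 0.
  by move: Hg; rewrite /s; case: (g) (d) => [m|m|] [n|n|] //=; case: eqP;
     rewrite ?oppr0 //; lia.
rewrite scale0r addr0; case: (eqVneq d NSC) => [->|/eqP dC].
  by case: (g) Hg => //= *; rewrite scale0r.
rewrite HN ?scaler0 //.
by move: Hg dC; rewrite /s; case: (g) (d) => [m|m|] [n|n|] //=; lia.
Qed.

End Module.

(** * Weights of a highest weight module *)

Section Weights.
Variables (c h : F) (V : lieModule (NS F)) (u : V).
Implicit Types (v : V).
Hypothesis uP : highest_weight c h u.

(** As [NSG i] is [G_(1/2 + i)], the condition [i < 0] selects exactly the odd elements of negative
    degree. *)
Definition ns_neg (g : ns_idx) : bool :=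
  match g with NSL n => n < 0 | NSG i => i < 0 | NSC => false end.

Lemma hw_raise g : g <> NSC -> g <> NSL 0 -> ~~ ns_neg g -> act (bas g) u = 0.
Proof.
move=> gC g0 nHg; apply: (hw_n_plus uP); apply: span_sub.
case: g gC g0 nHg => [n|i|] //= _ g0 nHg.
  left; exists n => //; rewrite lt0r; apply/andP; split; last by lia.
  by apply/eqP => n0; apply: g0; rewrite n0.
right; exists i => //; rewrite /half_int.
by apply: ltr_wpDr; rewrite ?ler0z ?invr_gt0 ?ltr0n //; lia.
Qed.

Lemma hw_raise_ge1 g : ns_ge 1 g -> act (bas g) u = 0.
Proof.
move=> Hg; apply: hw_raise; try by move=> E; rewrite E in Hg.
by case: g Hg => //= i; lia.
Qed.

Lemma hw_nilpotent (v : V) : ns_nilpotent v.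
Proof.
by apply: (hw_gen uP) (@ns_nil_submodule V) _ v; exists 1%N; exact: hw_raise_ge1.
Qed.

(** Monomials in the lowering elements, in any order, applied to [u]; they will span [V]. *)
Inductive word : V -> Prop :=
| word_nil : word u
| word_cons g v : ns_neg g -> word v -> word (act (bas g) v).

Lemma span_word_neg g v : ns_neg g -> span word v -> span word (act (bas g) v).
Proof.
move=> Hg; move: v; apply: span_ind => [|k v w Hv Hw|v Hv].
- by rewrite linear0; exact: span0.
- by rewrite linearP; exact: span_lin.
- by apply: span_sub; apply: word_cons.
Qed.

(** Induction on the word: moving [g] past the leading letter leaves a bracket and a multiple of
    [C], which act on the shorter word. *)
Lemma span_word_act g v : word v -> span word (act (bas g) v).
Proof.
move=> Hv; elim: Hv g => [|d w Hd Hw IH] g.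
  have [Hg|nHg] := boolP (ns_neg g).
    by apply: span_sub; apply: word_cons => //; exact: word_nil.
  have Su : span word u by apply: span_sub; exact: word_nil.
  have [->|/eqP gC] := eqVneq g NSC.
    have -> : act (bas NSC) u = c *: u by exact: (hw_C uP).
    exact: subspaceZ.
  have [->|/eqP g0] := eqVneq g (NSL 0).
    have -> : act (bas (NSL 0)) u = h *: u by exact: (hw_L0 uP).
    exact: subspaceZ.
  by rewrite hw_raise //; exact: span0.
rewrite act_bas_comm; apply: subspaceD; first apply: subspaceD.
- exact: subspaceZ (IH _).
- exact: subspaceZ (IH _).
- by apply: subspaceZ; apply: span_word_neg.
Qed.

Lemma word_homogeneous v : word v -> exists p, part p v.
Proof.
elim=> [|g w _ _ [p Hp]]; first by exists false; exact: (hw_even uP).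
by exists (ns_deg g (+) p); apply: act_part Hp; exact: bas_part.
Qed.

Lemma span_word v : span word v.
Proof.
apply: (hw_gen uP); last by apply: span_sub; exact: word_nil.
split=> [q w|x w].
  move: w; apply: span_ind => [|k w w' Hw Hw'|w Hw].
  - by rewrite linear0; exact: span0.
  - by rewrite linearP; exact: span_lin.
  have [p Hp] := word_homogeneous Hw.
  have [->|npq] := eqVneq q p; first by rewrite (proj_id Hp); exact: span_sub.
  have -> : q = ~~ p by case: p q npq {Hp} => -[].
  by rewrite (proj_other Hp); exact: span0.
move: w; apply: span_ind => [|k w w' Hw Hw'|w Hw].
- by rewrite linear0; exact: span0.
- by rewrite linearP; exact: span_lin.
by apply: act_bas_ind => g; exact: span_word_act.
Qed.

Notation L0 := (act (nsL F 0)).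

Lemma word_weight v : word v ->
  v = u \/ exists n : nat, L0 v = (h - n.+1%:R / 2) *: v.
Proof.
suff H : word v -> exists n : nat, L0 v = (h - n%:R / 2) *: v /\ (n = 0%N -> v = u).
  by move=> /H [[|n] [E Eu]]; [left; exact: Eu|right; exists n].
elim=> [|g w Hg _ [n [E _]]].
  by exists 0%N; split=> //; rewrite mul0r subr0 (hw_L0 uP).
have L0g : L0 (act (bas g) w) = ns_c F (NSL 0) g *: act (bas g) w + act (bas g) (L0 w).
  have := act_bas_comm (NSL 0) g w.
  rewrite /ksign expr0 scale1r => ->; congr (_ + _).
  case: g Hg => [i|i|] //= Hi; rewrite add0r; last by rewrite scale0r addr0.
  by rewrite ifN ?scale0r ?addr0 //; lia.
rewrite L0g E linearZ /= -scalerDl.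
case: g Hg {L0g} => [[m|m]|[m|m]|] //= _.
- exists (n + m.+1 * 2)%N; split; last by move=> ?; exfalso; lia.
  by congr (_ *: _); rewrite NegzE intrN natrD natrM; field.
- exists (n + m * 2 + 1)%N; split; last by move=> ?; exfalso; lia.
  by congr (_ *: _); rewrite /half_int NegzE intrN !natrD natrM; field.
Qed.

(* The product of the [L_0 - (h - n/2)], [1 <= n <= N]: it kills the weights below
   [h] and is invertible on the weight space of [h]. *)
Fixpoint weight_ann (N : nat) (v : V) : V :=
  if N is n.+1 then L0 (weight_ann n v) - (h - N%:R / 2) *: weight_ann n v else v.

Lemma weight_ann_linear N : linear (weight_ann N).
Proof.
elim: N => [|N IH] k v w //=; rewrite IH linearP /= !scalerDr !scalerN !scalerA.
by rewrite [_ * k]mulrC opprD addrACA.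
Qed.
HB.instance Definition _ N :=
  GRing.isLinear.Build F V V *:%R (weight_ann N) (weight_ann_linear N).

Lemma weight_ann_eigen N (mu : F) v : L0 v = mu *: v ->
  weight_ann N v = (\prod_(n < N) (mu - h + n.+1%:R / 2)) *: v.
Proof.
move=> E; elim: N => [|N IH] /=; first by rewrite big_ord0 scale1r.
rewrite IH linearZ /= E !scalerA -scalerBl big_ord_recr /=; congr (_ *: _); ring.
Qed.

Lemma weight_annD N m v : weight_ann N v = 0 -> weight_ann (N + m) v = 0.
Proof.
by move=> E; elim: m => [|m IH]; rewrite ?addn0 // addnS /= IH linear0 scaler0 subr0.
Qed.

(** Expanding in words, some [v - k *: u] is a sum of vectors of weight below [h], so a
    [weight_ann N] kills it. It also has weight [h], where [weight_ann N] is the product of the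
    nonzero numbers [n/2], [1 <= n <= N]. *)
Lemma highest_weight_space v : L0 v = h *: v -> exists k, v = k *: u.
Proof.
have [k [N E]] : exists k N, weight_ann N (v - k *: u) = 0.
  have := span_word v; move: v; apply: span_ind => [|k v w [i [N Hi]] [j [M Hj]]|v Hv].
  - by exists 0, 0%N; rewrite scale0r subr0.
  - exists (k * i + j), (N + M)%N.
    have -> : k *: v + w - (k * i + j) *: u = k *: (v - i *: u) + (w - j *: u).
      by rewrite scalerDl scalerBr scalerA opprD addrACA.
    by rewrite linearP /= weight_annD // addnC weight_annD // scaler0 addr0.
  have [->|[n E]] := word_weight Hv; first by exists 1, 0%N; rewrite scale1r subrr.
  exists 0, n.+1; rewrite scale0r subr0 (weight_ann_eigen _ E) big_ord_recr /=.
  have -> : h - n.+1%:R / 2 - h + n.+1%:R / 2 = 0 by ring.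
  by rewrite mulr0 scale0r.
move=> Ev; exists k; apply/eqP; rewrite -subr_eq0; apply/eqP; move: E.
have Ek : L0 (v - k *: u) = h *: (v - k *: u).
  by rewrite linearB linearZ /= Ev (hw_L0 uP) scalerBr !scalerA mulrC.
rewrite (weight_ann_eigen _ Ek) => /eqP; rewrite scaler_eq0 => /orP[|/eqP //].
rewrite prodf_seq_eq0 => /hasP[n _] /=.
by rewrite subrr add0r mulf_eq0 invr_eq0 !pnatr_eq0.
Qed.

End Weights.
End HighestWeight.

(** * Bases of SA' *)

Section WeightBasis.
Variables (F : numFieldType) (a b : F).

Notation bas k := (<< k >> : NS F).

Definition sa_pos (k : sa_idx) : int := match k with SAx j => j | SAy j => j end.

(* [e k] stands for the image of the basis vector [k] of [SA a b] in [W], which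
   is put to [0] outside [D]. *)
Record weight_basis (W : lieModule (NS F)) (D : pred sa_idx) (K : int)
    (e : sa_idx -> W) (co : sa_idx -> W -> F) : Prop := WeightBasis {
  wb_act : forall g k, D k -> D (sa_i g k) ->
    act (bas g) (e k) = sa_c a b g k *: e (sa_i g k);
  wb_large : forall k, K <= sa_pos k -> D k;
  wb_out : forall k, ~~ D k -> e k = 0;
  wb_co_lin : forall k, scalar (co k);
  wb_co : forall k l, D k -> co k (e l) = (k == l)%:R;
  wb_span : forall w, span (fun w => exists k, w = e k) w;
  wb_live : forall k, D k -> sa_live a b k }.

Lemma mcoeff_basis (k l : sa_idx) : (<< l >> : {malg F[sa_idx]})@_k = (k == l)%:R.
Proof. by rewrite mcoeffU eq_sym. Qed.

Lemma mcoeff_scalar (k : sa_idx) : scalar (fun w : {malg F[sa_idx]} => w@_k).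
Proof. by move=> c v w; rewrite mcoeffD mcoeffZ. Qed.

Lemma weight_basis_sub (H : sa_sub_case a b) :
  exists D K e co, @weight_basis (submodule (sa_sub_submodule H)) D K e co.
Proof.
case: (H) => -[n an] b1.
(* The omitted vector is [x_(-a)] with [a = n]; hence the bound [1 - n] below. *)
pose D (k : sa_idx) := k != SAx (- n).
pose e k : sub_lmod (sa_sub a b) := if D k then insubd 0 << k >> else 0.
have eE k : D k -> val (e k) = << k >>.
  move=> Dk; rewrite /e Dk val_insubd ifT //; apply/asboolP; apply: span_sub.
  case: k Dk => j Dk; [right|left]; exists j => //.
  rewrite an -intrN => /eqP; rewrite eqr_int => /eqP jn.
  by move: Dk; rewrite /D jn eqxx.
exists D, (1 - n), e, (fun k w => (val w)@_k); split.
- move=> g k Dk Dgk; apply: val_inj; rewrite [LHS]/= eE //.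
  by rewrite -[RHS]/(_ *: val (e _)) eE //; exact: sa_act_basisE.
- by move=> [j|j] //= Hj; apply/eqP => -[]; lia.
- by move=> k nDk; rewrite /e ifN.
- by move=> k c v w; exact: mcoeff_scalar.
- move=> k l Dk; have [Dl|nDl] := boolP (D l); first by rewrite eE // mcoeff_basis.
  rewrite /e ifN // mcoeff0; case: eqP => // kl.
  by move: nDl; rewrite -kl Dk.
- move=> w; have [w' <- //] : exists2 w', w' = w & span (fun w => exists k, w = e k) w'.
  (* The span induction takes place in [SA], so a preimage in the submodule is carried along. *)
  have [w' E Sw'] : exists2 w', val w' = val w & span (fun w => exists k, w = e k) w'.
    have := sub_lmodP w; move: (val w).
    apply: span_ind => [|k x y [x' <- Hx] [y' <- Hy]|x Hx].
    + by exists 0 => //; exact: subspace0.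
    + by exists (k *: x' + y') => //; exact: subspace_lin.
    have [k Dk ->] : exists2 k, D k & x = << k >>.
      case: Hx => [[j ->]|[j Hj ->]]; [exists (SAy j)|exists (SAx j)] => //.
      by apply/eqP => -[E]; apply: Hj; rewrite an E intrN.
    by exists (e k); [exact: eE|apply: span_sub; exists k].
  by exists w' => //; exact: val_inj.
move=> [j|j] //= _; apply/implyP => /eqP; rewrite b1 => /eqP.
by rewrite -subr_eq0 [X in X == 0](_ : _ = 2^-1) ?invr_eq0 ?pnatr_eq0 //; field.
Qed.

Lemma weight_basis_quot (H : sa_quot_case a b) :
  exists D K e co, @weight_basis (quotient_module (sa_ker_submodule H)) D K e co.
Proof.
case: (H) => -[n an] b1.
(* Since [a = 1/2 + n], the vector [y_(-a)] has index [-1 - n]. *)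
pose D (k : sa_idx) := k != SAy (- 1 - n).
have half_opp : half_int F (- 1 - n) = - a.
  by rewrite an /half_int intrB intrN; field.
have DE k : D k -> forall x, sa_ker a b x -> x@_k = 0.
  move=> Dk; apply: span_ind => [|c v w Hv Hw|_ [j Hj ->]].
  - exact: mcoeff0.
  - by rewrite mcoeffD mcoeffZ Hv Hw mulr0 addr0.
  rewrite mcoeff_basis; case: eqP => // kj; move: Dk; rewrite /D kj.
  move/eqP: Hj; rewrite -half_opp half_int_eq => /eqP ->.
  by rewrite eqxx.
pose e k : quot_lmod (sa_ker a b) := quot_pi (sa_ker a b) << k >>.
(* The value 0 at the killed index lets every [cf k] descend to the quotient. *)
pose cf k (v : {malg F[sa_idx]}) : F^o := if D k then v@_k else 0.
have cf_lin k : linear (cf k).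
  by move=> c v w; rewrite /cf; case: ifP => _;
    rewrite ?scaler0 ?addr0 // mcoeff_scalar.
have cf_ker k x : sa_ker a b x -> cf k x = 0.
  by rewrite /cf; case: ifP => // /DE; apply.
exists D, (- n), e, (fun k => quot_lift (cf k)); split.
- move=> g k Dk Dgk; rewrite [LHS]quot_actE /e -linearZ /=; congr quot_pi.
  exact: sa_act_basisE.
- by move=> [j|j] //= Hj; apply/eqP => -[]; lia.
- move=> k; rewrite negbK => /eqP ->; apply: quot_pi_eq0; apply: span_sub.
  by exists (- 1 - n).
- by move=> k; apply: (quot_lift_linear (cf_lin k) (@cf_ker k)).
- by move=> k l Dk; rewrite (quot_liftE (cf_lin k) (@cf_ker k)) /cf Dk mcoeff_basis.
- elim/quot_pi_ind => w; apply: (malg_ind (P := fun w => span _ (quot_pi _ w))).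
  + by rewrite quot_pi0; exact: subspace0.
  + by move=> k x y Hx Hy; rewrite linearP; exact: subspace_lin.
  + by move=> k; apply: span_sub; exists k.
move=> [j|j] //= Dj; apply/implyP => _; rewrite addrC addr_eq0 -half_opp half_int_eq.
by apply: contra Dj => /eqP ->.
Qed.

(** A basis vector that is not live forces [b = 1/2] and [a] in [1/2 + Z], which is the quotient
    case. *)
Lemma weight_basis_gen : ~ sa_quot_case a b ->
  exists D K e co, @weight_basis (SA a b) D K e co.
Proof.
move=> H; exists predT, 0, (fun k => << k >>), (fun k w => w@_k); split=> //.
- by move=> g k _ _; exact: sa_act_basisE.
- by move=> k; exact: mcoeff_scalar.
- by move=> k l _; exact: mcoeff_basis.
- apply: malg_ind => [|k x y Hx Hy|k]; first exact: subspace0.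
    exact: subspace_lin.
  by apply: span_sub; exists k.
move=> [j|j] //= _; apply/implyP => /eqP b1; apply/negP => E.
apply: H; split=> //; exists (- 1 - j); move: E; rewrite addr_eq0 => /eqP ->.
by rewrite /half_int intrB intrN; field.
Qed.

Lemma SA'_weight_basis : exists D K e co, @weight_basis (SA' a b) D K e co.
Proof.
rewrite /SA'; case: pselect => [H|_]; first exact: weight_basis_sub.
case: pselect => [H|H]; [exact: weight_basis_quot|exact: weight_basis_gen].
Qed.

End WeightBasis.

(** * Endomorphisms of the tensor product *)

(* [T] and [ot] stand for [tensor_module V W] and [otimes], and [coef k] for the
   coordinate of index [k] in the second factor. *)
Section TensorEnd.
Variables (F : numFieldType) (a b c h : F).
Variables (V W T : lieModule (NS F)) (u : V) (ot : V -> W -> T).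
Variables (D : pred sa_idx) (K : int) (e : sa_idx -> W) (co : sa_idx -> W -> F).
Variable coef : sa_idx -> T -> V.

Notation bas k := (<< k >> : NS F).

Hypothesis uP : highest_weight c h u.
Hypothesis WP : weight_basis a b D K e co.
Hypothesis ot_linl : forall w, linear (ot ^~ w).
Hypothesis ot_linr : forall v, linear (ot v).
Hypothesis ot_ind : forall P : T -> Prop, P 0 ->
  (forall k s t, P s -> P t -> P (k *: s + t)) ->
  (forall v w, P (ot v w)) -> forall t, P t.
Hypothesis act_ot : forall p q (x : NS F) v w, part p x -> part q v ->
  act x (ot v w) = ot (act x v) w + ksign p q *: ot v (act x w).
Hypothesis coef_linear : forall k, linear (coef k).
Hypothesis coefE : forall k v w, coef k (ot v w) = co k w *: v.

Notation "v ⊗ w" := (ot v w) (at level 40).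

Lemma otDl v v' w : (v + v') ⊗ w = v ⊗ w + v' ⊗ w.
Proof. by have := ot_linl w 1 v v'; rewrite !scale1r. Qed.

Lemma ot0l w : 0 ⊗ w = 0.
Proof. by apply: (addrI (0 ⊗ w)); rewrite -otDl !addr0. Qed.

Lemma otZl k v w : (k *: v) ⊗ w = k *: (v ⊗ w).
Proof. by have := ot_linl w k v 0; rewrite ot0l !addr0. Qed.

Lemma otDr v w w' : v ⊗ (w + w') = v ⊗ w + v ⊗ w'.
Proof. by have := ot_linr v 1 w w'; rewrite !scale1r. Qed.

Lemma ot0r v : v ⊗ 0 = 0.
Proof. by apply: (addrI (v ⊗ 0)); rewrite -otDr !addr0. Qed.

Lemma otZr k v w : v ⊗ (k *: w) = k *: (v ⊗ w).
Proof. by have := ot_linr v k w 0; rewrite ot0r !addr0. Qed.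

Lemma coef0 k : coef k 0 = 0.
Proof. by have := coef_linear k (-1) 0 0; rewrite scaler0 addr0 scaleN1r addNr. Qed.

Lemma coefZ k r t : coef k (r *: t) = r *: coef k t.
Proof. by have := coef_linear k r t 0; rewrite coef0 !addr0. Qed.

Lemma coefD k t t' : coef k (t + t') = coef k t + coef k t'.
Proof. by have := coef_linear k 1 t t'; rewrite !scale1r. Qed.

Lemma act_ot_even (x : NS F) (v : V) (w : W) : part false x ->
  act x (v ⊗ w) = act x v ⊗ w + v ⊗ act x w.
Proof.
move=> Hx; rewrite {1 2 3}(proj_sum v) actDr !otDl actDr.
rewrite (act_ot _ Hx (proj_part false v)) (act_ot _ Hx (proj_part true v)).
by rewrite /ksign !expr0 !scale1r; exact: addrACA.
Qed.

Lemma coef_basis k l v : D k -> coef k (v ⊗ e l) = (k == l)%:R *: v.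
Proof. by move=> Dk; rewrite coefE (wb_co WP). Qed.

(** Asking for all larger sets [s'] lets two expansions be added over the union of their supports.
    Indices outside [D] contribute 0 because [e] vanishes there. *)
Lemma co_decomp (w : W) : exists s : {fset sa_idx},
  forall s', (s `<=` s')%fset -> w = \sum_(k <- s') co k w *: e k.
Proof.
have co0 k : co k 0 = 0.
  by have := wb_co_lin WP k (-1) 0 0; rewrite scaler0 addr0 mulN1r addNr.
have := wb_span WP w; move: w; apply: span_ind => [|r v w [s Hs] [s' Hs']|_ [l ->]].
- by exists fset0 => s' _; rewrite big1 // => k _; rewrite co0 scale0r.
- exists (s `|` s')%fset => s'' /[1!fsubUset] /andP[/Hs Ev /Hs' Ew].
  rewrite {1}Ev {1}Ew scaler_sumr -big_split; apply: eq_bigr => k _ /=.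
  by rewrite (wb_co_lin WP) scalerDl scalerA.
exists [fset l]%fset => s' /[1!fsub1set] ls.
rewrite (bigD1_seq l) ?fset_uniq //= big1 => [|k kl].
  have [Dl|nDl] := boolP (D l); last by rewrite (wb_out WP nDl) scaler0 addr0.
  by rewrite (wb_co WP) // eqxx scale1r addr0.
have [Dk|nDk] := boolP (D k); last by rewrite (wb_out WP nDk) scaler0.
by rewrite (wb_co WP) // (negbTE kl) scale0r.
Qed.

Lemma coef_decomp (t : T) : exists s : {fset sa_idx},
  forall s', (s `<=` s')%fset -> t = \sum_(k <- s') coef k t ⊗ e k.
Proof.
move: t; apply: ot_ind => [|r t t' [s Hs] [s' Hs']|v w].
- by exists fset0 => s' _; rewrite big1 // => k _; rewrite coef0 ot0l.
- exists (s `|` s')%fset => s'' /[1!fsubUset] /andP[/Hs Et /Hs' Et'].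
  rewrite {1}Et {1}Et' scaler_sumr -big_split; apply: eq_bigr => k _ /=.
  by rewrite coef_linear otDl otZl.
have [s Hs] := co_decomp w; exists s => s' /Hs E.
rewrite {1}E (big_morph _ (otDr v) (ot0r v)).
by apply: eq_bigr => k _; rewrite coefE otZl otZr.
Qed.

Lemma coef_inj (t : T) : (forall k, D k -> coef k t = 0) -> t = 0.
Proof.
move=> H; have [s /(_ s (fsubset_refl _)) ->] := coef_decomp t.
apply: big1 => k _; have [/H ->|nDk] := boolP (D k); first exact: ot0l.
by rewrite (wb_out WP nDk) ot0r.
Qed.

Lemma act_ot_nil p g (v : V) k : part p v -> act (bas g) v = 0 ->
  D k -> D (sa_i g k) ->
  act (bas g) (v ⊗ e k)
  = (ksign (ns_deg g) p * sa_c a b g k) *: (v ⊗ e (sa_i g k)).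
Proof.
move=> Hp Hv Dk Dgk; rewrite (act_ot _ (bas_part F g) Hp) Hv ot0l add0r.
by rewrite (wb_act WP) // otZr scalerA.
Qed.

Lemma sa_pos_le N g k : ns_ge N g -> N%:Z + sa_pos k <= sa_pos (sa_i g k).
Proof. by case: g k => [m|m|] [n|n] //=; lia. Qed.

(** Ensures that elements of index at least [N] move [k] into the range where [D] holds. *)
Definition sa_far N k := K <= N%:Z + sa_pos k.

Lemma sa_far_dom N g k : sa_far N k -> ns_ge N g -> D (sa_i g k).
Proof.
by move=> Hk /(sa_pos_le k) H; apply: (wb_large WP); exact: le_trans Hk H.
Qed.

Lemma sa_far_dom2 N g g' k : sa_far N k -> ns_ge N g -> ns_ge N g' ->
  D (sa_i g (sa_i g' k)).
Proof.
move=> Hk Hg Hg'; apply: (sa_far_dom _ Hg); apply: le_trans Hk _.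
rewrite lerD2l; apply: le_trans (sa_pos_le k Hg').
by rewrite lerDr.
Qed.

Lemma sa_farP k : exists N0, forall N, (N0 <= N)%N -> sa_far N k.
Proof. by exists (`|K| + `|sa_pos k|)%N => N; rewrite /sa_far; lia. Qed.

(** Both factors pass [v] with the same sign, so the signs cancel. *)
Lemma act2_ot_nil p N g g' (v : V) k : part p v ->
  (forall d, ns_ge N d -> act (bas d) v = 0) -> D k -> sa_far N k ->
  ns_ge N g -> ns_ge N g' -> ns_deg g = ns_deg g' ->
  act (bas g) (act (bas g') (v ⊗ e k))
  = sa_c2 a b g g' k *: (v ⊗ e (sa_i g (sa_i g' k))).
Proof.
move=> Hp Hv Dk Hk Hg Hg' gg'.
rewrite (act_ot_nil Hp) //; [|exact: Hv|exact: sa_far_dom Hg'].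
rewrite actZr (act_ot_nil Hp); 
  [|exact: Hv|exact: sa_far_dom Hg'|exact: sa_far_dom2 Hk Hg Hg'].
by rewrite scalerA gg' mulrACA ksign_sqr mul1r.
Qed.

Lemma sa_i_inj g : g <> NSC -> injective (sa_i g).
Proof. by case: g => [m|m|] // _ [i|i] [j|j] //= [E]; congr (_ _); lia. Qed.

(** On [x ⊗ e k] with [x] killed by both elements, [g g'] acts through the second factor, and
    injectivity of [sa_i] leaves only [k = l]. A general [t] is a finite combination of such
    tensors, with the maximum of their bounds. *)
Lemma coef_act2 l (t : T) : D l -> exists N, forall g g',
  ns_ge N g -> ns_ge N g' -> ns_deg g = ns_deg g' ->
  coef (sa_i g (sa_i g' l)) (act (bas g) (act (bas g') t))
  = sa_c2 a b g g' l *: coef l t.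
Proof.
move=> Dl; pose Q (t : T) := exists N, forall g g',
  ns_ge N g -> ns_ge N g' -> ns_deg g = ns_deg g' ->
  coef (sa_i g (sa_i g' l)) (act (bas g) (act (bas g') t))
  = sa_c2 a b g g' l *: coef l t.
have Q0 : Q 0 by exists 0%N => g g' _ _ _; rewrite !act0r !coef0 scaler0.
have Qlin k s s' : Q s -> Q s' -> Q (k *: s + s').
  move=> [N HN] [N' HN']; exists (maxn N N') => g g' Hg Hg' gg'.
  have [L R] := (leq_maxl N N', leq_maxr N N').
  rewrite !act_linr !coef_linear HN ?HN' //; try exact: ns_ge_leq Hg;
    try exact: ns_ge_leq Hg'.
  by rewrite scalerDr !scalerA mulrC.
apply: (ot_ind (P := Q)) => // {t} v w.
have := wb_span WP w; move: w.
apply: span_ind => [|k w w' Hw Hw'|_ [k ->]]; first by rewrite ot0r.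
  by rewrite ot_linr; exact: Qlin.
have [Dk|nDk] := boolP (D k); last by rewrite (wb_out WP nDk) ot0r.
suff Qhom p (x : V) : part p x -> Q (x ⊗ e k).
  rewrite (proj_sum v) otDl -[X in Q (X + _)]scale1r.
  by apply: Qlin; apply: Qhom; exact: proj_part.
move=> Hp; have [N1 H1] := hw_nilpotent uP x.
have [N2 H2] := sa_farP k; have [N3 H3] := sa_farP l.
exists (N1 + N2 + N3)%N => g g' Hg Hg' gg'; set N := (N1 + _ + _)%N in Hg Hg'.
have nil d : ns_ge N d -> act (bas d) x = 0.
  by move=> Hd; apply: H1; apply: ns_ge_leq Hd; rewrite /N -addnA leq_addr.
have fk : sa_far N k by apply: H2; rewrite /N addnAC leq_addl.
have fl : sa_far N l by apply: H3; rewrite /N leq_addl.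
rewrite (act2_ot_nil Hp nil Dk fk Hg Hg' gg') coefZ.
rewrite !coef_basis //; last exact: sa_far_dom2 fl Hg Hg'.
have inj d : ns_ge N d -> injective (sa_i d).
  by move=> Hd; apply: sa_i_inj => E; rewrite E in Hd.
rewrite (inj_eq (inj g Hg)) (inj_eq (inj g' Hg')).
by have [->|_] := eqVneq l k; rewrite ?scale1r // !scale0r !scaler0.
Qed.

(** * A commuting endomorphism is a scalar *)

Variable f : T -> T.
Hypothesis fP : is_lie_end f.

Let f_lin : linear f. Proof. by case: fP. Qed.
Let f_act x t : f (act x t) = act x (f t). Proof. by case: fP => _; apply. Qed.
Let f0 : f 0 = 0.
Proof. by have := f_lin (-1) 0 0; rewrite scaler0 addr0 scaleN1r addNr. Qed.
Let fZ k t : f (k *: t) = k *: f t.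
Proof. by have := f_lin k t 0; rewrite f0 !addr0. Qed.

Lemma end_basis k : D k -> exists v, f (u ⊗ e k) = v ⊗ e k.
Proof.
move=> Dk; exists (coef k (f (u ⊗ e k))); set t := f _.
suff E : t + -1 *: (coef k t ⊗ e k) = 0 by apply/eqP; rewrite -subr_eq0 -scaleN1r E.
apply: coef_inj => l Dl; rewrite coefD coefZ coef_basis //.
have [->|lk] := eqVneq l k; first by rewrite scale1r scaleN1r subrr.
rewrite scale0r scaler0 addr0.
have [N1 H1] := coef_act2 t Dl; have [N2 H2] := sa_farP k.
have kl : k != l by rewrite eq_sym.
(* [N1] serves the coordinate [l] of [t], [N2] keeps the images of [k] in [D], and the 1 makes the
   elements kill [u]. *)
have [g [g' [d [d' [Hg Hg' Hd Hd' [gg' dd' gd det]]]]]] :=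
  separation (N1 + N2 + 1) kl (wb_live WP Dk) (wb_live WP Dl).
set N := (N1 + N2 + 1)%N in Hg Hg' Hd Hd'.
have nil x : ns_ge N x -> act (bas x) u = 0.
  by move=> Hx; apply: (hw_raise_ge1 uP); apply: ns_ge_leq Hx; rewrite /N leq_addl.
have fk : sa_far N k by apply: H2; rewrite /N addnAC leq_addl.
have le1 x : ns_ge N x -> ns_ge N1 x by apply: ns_ge_leq; rewrite /N -addnA leq_addr.
have E : sa_c2 a b d d' k *: act (bas g) (act (bas g') (u ⊗ e k))
       = sa_c2 a b g g' k *: act (bas d) (act (bas d') (u ⊗ e k)).
  rewrite (act2_ot_nil (hw_even uP) nil Dk fk Hg Hg' gg').
  rewrite (act2_ot_nil (hw_even uP) nil Dk fk Hd Hd' dd').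
  by rewrite !scalerA gd mulrC.
(* Applying [f] to the relation and reading the coordinate reached from [l] gives the nonzero
   determinant times [coef l t] equal to 0. *)
have := congr1 (fun t => coef (sa_i g (sa_i g' l)) (f t)) E.
rewrite !fZ !f_act -/t !coefZ {2}gd.
rewrite !H1 ?le1 // !scalerA => /eqP; rewrite -subr_eq0 -scalerBl scaler_eq0.
by rewrite subr_eq0 eq_sym (negbTE det) => /eqP.
Qed.

(** [L_0] acts on [e k] by a scalar, so commuting with it forces the first factor of the image to
    have weight [h]. *)
Lemma end_eigen k : D k -> exists r, f (u ⊗ e k) = r *: (u ⊗ e k).
Proof.
move=> Dk; have [v E] := end_basis Dk.
have i0 : sa_i (NSL 0) k = k by case: (k) => j /=; rewrite add0r.
have L0e : act (bas (NSL 0)) (e k) = sa_c a b (NSL 0) k *: e k.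
  by have := @wb_act _ _ _ _ _ _ _ _ WP (NSL 0) k Dk; rewrite i0 => ->.
have even : part false (bas (NSL 0)) := bas_part F (NSL 0).
have : f (act (bas (NSL 0)) (u ⊗ e k)) = act (bas (NSL 0)) (f (u ⊗ e k)) by [].
rewrite E (act_ot_even _ _ even) (act_ot_even _ _ even) L0e.
rewrite (hw_L0 uP) otZl !otZr -scalerDl fZ E.
move=> /(congr1 (coef k)); rewrite coefD !coefZ !coef_basis // eqxx !scale1r.
rewrite scalerDl => /addIr /esym L0v.
have [r ->] := highest_weight_space uP L0v.
by exists r; rewrite otZl.
Qed.

Lemma end_eigen_eq g k r s : ns_ge 1 g -> D k -> D (sa_i g k) ->
  sa_c a b g k != 0 -> f (u ⊗ e k) = r *: (u ⊗ e k) ->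
  f (u ⊗ e (sa_i g k)) = s *: (u ⊗ e (sa_i g k)) -> r = s.
Proof.
move=> Hg Dk Dgk c0 Er Es.
have E : act (bas g) (u ⊗ e k) = sa_c a b g k *: (u ⊗ e (sa_i g k)).
  by rewrite (act_ot_nil (hw_even uP) (hw_raise_ge1 uP Hg)) // /ksign andbF expr0 mul1r.
have := f_act (bas g) (u ⊗ e k); rewrite E Er fZ actZr E Es.
move=> /(congr1 (coef (sa_i g k))); rewrite !coefZ !coef_basis // eqxx scale1r.
rewrite !scalerA => /eqP; rewrite -subr_eq0 -scalerBl scaler_eq0 => /orP[|/eqP u0].
  by rewrite mulrC -mulrBl mulf_eq0 (negbTE c0) orbF subr_eq0 => /eqP.
by case: (hw_neq0 uP).
Qed.

(** From [x_j] a single [G] reaches any far [SAy m] with coefficient 1; from a [y_j] one first moves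
    to some [x]. *)
Lemma end_eigen_far k r : D k -> f (u ⊗ e k) = r *: (u ⊗ e k) ->
  exists N : nat, forall (m : nat) s, (N <= m)%N ->
    f (u ⊗ e (SAy m)) = s *: (u ⊗ e (SAy m)) -> r = s.
Proof.
have from_x j r' : D (SAx j) -> f (u ⊗ e (SAx j)) = r' *: (u ⊗ e (SAx j)) ->
    exists N : nat, forall (m : nat) s, (N <= m)%N ->
      f (u ⊗ e (SAy m)) = s *: (u ⊗ e (SAy m)) -> r' = s.
  move=> Dk Er; exists (`|K| + `|j| + 1)%N => m s Hm Es.
  have Ei : sa_i (NSG (m%:Z - j)) (SAx j) = SAy m by rewrite /= subrK.
  apply: (end_eigen_eq (g := NSG (m%:Z - j)) _ Dk _ _ Er); rewrite ?Ei //=.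
  - lia.
  - by apply: (wb_large WP) => /=; lia.
  - exact: oner_neq0.
case: k => j Dk Er; first exact: from_x Er.
pose N := (`|K| + `|j| + 1)%N.
(* The coefficient is affine in [m] with slope [2b - 1]; at [b = 1/2] it is the constant
   [a + half_int F j], nonzero by [wb_live]. *)
have [m Hm] : exists m : nat, sa_c a b (NSG (N + m)%:Z) (SAy j) != 0.
  have [|m Hm] := @affine_neq0 F
    (a + half_int F j + 2 * half_int F N%:Z * (b - 2^-1)) (2 * (b - 2^-1)).
    rewrite mulf_eq0 pnatr_eq0 subr_eq0 /=.
    have [bE|] := eqVneq b 2^-1; last by rewrite orbT.
    have := wb_live WP Dk.
    by rewrite /= bE eqxx subrr mulr0 addr0 orbF.
  exists m; apply: contra Hm => /eqP E; apply/eqP; rewrite -[RHS]E /= /half_int.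
  by rewrite PoszD intrD -!pmulrn; ring.
have Dx : D (sa_i (NSG (N + m)%:Z) (SAy j)).
  by apply: (wb_large WP); rewrite /= /N; lia.
have [s Es] := end_eigen Dx.
have -> : r = s.
  by apply: end_eigen_eq Hm Er Es => //=; rewrite /N; lia.
exact: from_x Es.
Qed.

Lemma end_const : exists r, forall k, D k -> f (u ⊗ e k) = r *: (u ⊗ e k).
Proof.
have D0 : D (SAy `|K|%N) by apply: (wb_large WP) => /=; lia.
have [r Er] := end_eigen D0; exists r => k Dk.
have [s Es] := end_eigen Dk; rewrite Es; congr (_ *: _).
have [N1 H1] := end_eigen_far D0 Er; have [N2 H2] := end_eigen_far Dk Es.
pose m := (`|K| + N1 + N2)%N.
have [q Eq] : exists q, f (u ⊗ e (SAy m)) = q *: (u ⊗ e (SAy m)).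
  by apply: end_eigen; apply: (wb_large WP); rewrite /= /m; lia.
by rewrite (H1 m q _ Eq) ?(H2 m q _ Eq) // /m ?leq_addl // addnAC leq_addl.
Qed.

Lemma end_scalar : exists r, forall t, f t = r *: t.
Proof.
have [r Hr] := end_const; exists r.
(* Stated on homogeneous components, where the sign rule applies; [P] then defines a graded
   submodule, which is all of [V] as it contains [u]. *)
pose P v := forall q w, f (proj q v ⊗ w) = r *: (proj q v ⊗ w).
have P0 : P 0 by move=> q w; rewrite linear0 ot0l f0 scaler0.
have Plin k v v' : P v -> P v' -> P (k *: v + v').
  move=> Hv Hv' q w; rewrite proj_linear ot_linl f_lin Hv Hv' scalerDr !scalerA.
  by rewrite mulrC.
pose S := Subspace P0 Plin.
have subS : is_submodule S.
  split=> [p v Pv q w|x v Pv].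
    have [->|npq] := eqVneq q p; first by rewrite (proj_id (proj_part p v)).
    have -> : q = ~~ p by case: p q npq => -[].
    by rewrite (proj_other (proj_part p v)) ot0l f0 scaler0.
  apply: act_bas_ind => g q w.
  have -> : proj q (act (bas g) v) = act (bas g) (proj (ns_deg g (+) q) v).
    by rewrite (act_proj _ _ (bas_part F g)) addKb.
  set y := proj _ v.
  (* The action on [y ⊗ w] solved for its first term; [f] is known on both terms on the right. *)
  have -> : act (bas g) y ⊗ w
    = - ksign (ns_deg g) (ns_deg g (+) q) *: (y ⊗ act (bas g) w)
      + act (bas g) (y ⊗ w).
    rewrite (act_ot _ (bas_part F g) (proj_part _ v)) -/y scaleNr addrC addrK //.
  by rewrite f_lin f_act !Pv actZr scalerDr !scalerA mulrC.
have PV v : P v.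
  apply: (hw_gen uP subS _ v) => -[] w.
    by rewrite (proj_other (hw_even uP)) ot0l f0 scaler0.
  rewrite (proj_id (hw_even uP)).
  have := wb_span WP w; move: w; apply: span_ind => [|k w w' Hw Hw'|_ [k ->]].
  - by rewrite ot0r f0 scaler0.
  - by rewrite ot_linr f_lin Hw Hw' scalerDr !scalerA mulrC.
  have [|nDk] := boolP (D k); first exact: Hr.
  by rewrite (wb_out WP nDk) ot0r f0 scaler0.
apply: ot_ind => [|k s t Hs Ht|v w]; first by rewrite f0 scaler0.
  by rewrite f_lin Hs Ht scalerDr !scalerA mulrC.
rewrite (proj_sum v) otDl -[X in f (X + _)]scale1r f_lin !PV.
by rewrite scale1r scalerDr.
Qed.

End TensorEnd.

(** * The algebra morphism from scalars to endomorphisms *)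

Section ScalarEnd.
Variables (F : numFieldType) (g : lieSuperalgebra F) (M : lieModule g).

Definition scalar_end (k : F^o) : lieEnd M := (k : F) *: (1 : lieEnd M).

Lemma scalar_endE k t : val (scalar_end k) t = k *: t.
Proof. by []. Qed.

Lemma scalar_end_linear : linear scalar_end.
Proof. by move=> k x y; rewrite /scalar_end scalerDl -scalerA. Qed.
HB.instance Definition _ :=
  GRing.isLinear.Build F F^o (lieEnd M) *:%R scalar_end scalar_end_linear.

Lemma scalar_end_monoid : monoid_morphism scalar_end.
Proof.
split; first exact: scale1r.
move=> x y; apply: val_inj; apply/funext => t.
by rewrite -[RHS]/(val (scalar_end x) (val (scalar_end y) t)) !scalar_endE scalerA.
Qed.
HB.instance Definition _ :=
  GRing.isMonoidMorphism.Build F^o (lieEnd M) scalar_end scalar_end_monoid.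

(** The inverse chooses the scalar of each endomorphism; evaluation at the nonzero [t] shows that
    this scalar is unique. *)
Lemma scalar_end_bij (t : M) : t <> 0 ->
  (forall f : M -> M, is_lie_end f -> exists r, forall s, f s = r *: s) ->
  bijective scalar_end.
Proof.
move=> t0 H.
have /choice[r Hr] (f : lieEnd M) : exists r, forall s, val f s = r *: s.
  exact/H/lieEndP.
exists r => [k|f].
  have := Hr (scalar_end k) t; rewrite scalar_endE => /eqP.
  by rewrite -subr_eq0 -scalerBl scaler_eq0 subr_eq0 => /orP[/eqP|/eqP].
by apply: val_inj; apply/funext => s; rewrite scalar_endE Hr.
Qed.

End ScalarEnd.

(** * Coordinates along the second tensor factor *)

Section TensorCoef.
Variables (F : numFieldType) (V W : lmodType F) (co : W -> F).
Hypothesis co_lin : scalar co.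

Definition tens_coef : tens V W -> V := tens_lift (fun v w => co w *: v).

Let co_linl (w : W) : linear (fun v : V => co w *: v).
Proof. by move=> r v v'; rewrite scalerDr !scalerA mulrC. Qed.

Let co_linr (v : V) : linear (fun w : W => co w *: v).
Proof. by move=> r w w'; rewrite co_lin scalerDl scalerA. Qed.

Lemma tens_coef_linear : linear tens_coef.
Proof. exact: tens_lift_linear co_linl co_linr. Qed.

Lemma tens_coefE v w : tens_coef (otimes v w) = co w *: v.
Proof. exact: (tens_liftE co_linl co_linr). Qed.

End TensorCoef.

Lemma tensor_scalar_end_bij (F : numFieldType) (a b c h : F)
    (V : lieModule (NS F)) (u : V) :
  highest_weight c h u -> bijective (scalar_end (tensor_module V (SA' a b))).
Proof.
move=> uP.
have [D [K [e [co WP]]]] := SA'_weight_basis a b.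
(* An index in [D]: the coordinate of [u ⊗ e k] at [k] is [u], so this tensor is nonzero. *)
pose k := SAx `|K|%N.
have Dk : D k by apply: (wb_large WP) => /=; lia.
apply: (@scalar_end_bij _ _ (tensor_module V (SA' a b)) (otimes u (e k))) => [E|f fP].
  have := tens_coefE (wb_co_lin WP k) u (e k).
  have coef0 : tens_coef (co k) 0 = 0 :> V.
    have := tens_coef_linear (V := V) (wb_co_lin WP k) (-1) 0 0.
    by rewrite scaler0 addr0 scaleN1r addNr.
  rewrite [otimes u (e k)]E coef0 (wb_co WP) // eqxx scale1r => u0.
  exact: (hw_neq0 uP (esym u0)).
apply: (@end_scalar F a b c h V (SA' a b) (tensor_module V (SA' a b)) u
  (@otimes F V (SA' a b)) D K e co (fun k => tens_coef (co k)) uP WP _ _ _ _ _ _ f fP).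
- exact: otimes_linl.
- exact: otimes_linr.
- exact: tens_ind.
- by move=> p q x v w Hx Hv; exact: tens_actE.
- by move=> l; exact: tens_coef_linear (wb_co_lin WP l).
- by move=> l v w; exact: tens_coefE (wb_co_lin WP l) v w.
Qed.

Theorem theorem2p2 (R : realType) (a b c h : R[i])
    (V : lieModule (NS R[i])) (u : V) :
  highest_weight c h u ->
  exists phi : {lrmorphism R[i]^o -> lieEnd (tensor_module V (SA' a b))},
    bijective phi.
Proof.
by move=> uP; exists (scalar_end _); exact: tensor_scalar_end_bij uP.
Qed.
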